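(* There exists a universal constant $C>0$ such that the following holds. Let sets $I$ and $N$ be at most countable. Let $0<\varepsilon<1$. Suppose that for each $j\in N$, $\{u_i^{(j)}\}_{i\in I}$ is a Bessel sequence with bound $B_j$ in a Hilbert space $\mathcal H_j$, such that $$\|u_i^{(j)}\|^2=1\qquad\text{for all } i\in I,\ j\in N.$$ Define $\epsilon_j=1/B_j$ and suppose that $\sum_{j\in N}(1-\epsilon_j)<\infty$. Let $j_0\in N$ be such that the value $\epsilon_{j_0}$ is the smallest among all $\epsilon_j$, $j\in N$. Define $$r:=\frac C{\varepsilon^2}\bigg(1+\frac1{(\epsilon_{j_0})^2}\sum_{j\in N:\ \epsilon_j<1/2}\epsilon_j\bigg)\max\bigg(1,\ \sum_{j\in N:\ \epsilon_j<1/(1+\varepsilon)}\epsilon_j+\sum_{j\in N}(1-\epsilon_j)\bigg).$$ Assume $\{J_k\}_{k\in K}$ is a collection of disjoint subsets of $I$ satisfying $\#J_k\ge r$ for all $k\in K$. Then there exists a selector $J\subset\bigcup_kJ_k$ satisfying $\#(J\cap J_k)=1$ for all $k\in K$ such that for all $j\in N$ the system $\{u_i^{(j)}\}_{i\in J}$ is a Riesz sequence in $\mathcal H_j$ with bounds $1-\varepsilon$ and $1+\varepsilon$.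
   Context: A family $\{u_i\}_{i\in I}$ in a Hilbert space $\mathcal H$ is a Bessel sequence with bound $B$ if $\sum_{i\in I}|\langle f,u_i\rangle|^2\le B\|f\|^2$ for all $f\in\mathcal H$ (for unit vectors necessarily $B\ge1$). It is a Riesz sequence with bounds $A>0$ and $B<\infty$ if $A\sum|c_i|^2\le\|\sum c_iu_i\|^2\le B\sum|c_i|^2$ for all finitely supported scalar sequences $(c_i)$. *)

(* Defs.v *)
From HB Require Import structures.
From mathcomp Require Import all_boot all_order all_algebra.
From mathcomp Require Import all_classical all_reals all_analysis.
From mathcomp Require Import complex.

Set Implicit Arguments.
Unset Strict Implicit.
Unset Printing Implicit Defensive.

Import Order.TTheory GRing.Theory Num.Theory.
Import numFieldNormedType.Exports.

Local Open Scope classical_set_scope.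
Local Open Scope ring_scope.

(* Hilbert spaces are over the real or over the complex numbers. *)
Variant scalar_kind := RealScalars | ComplexScalars.

Definition scalars (R : realType) (k : scalar_kind) : numFieldType :=
  match k with RealScalars => R | ComplexScalars => R[i] end.

Definition scalar_conj (R : realType) (k : scalar_kind) :
    {rmorphism scalars R k -> scalars R k} :=
  match k return {rmorphism scalars R k -> scalars R k} with
  | RealScalars => idfun
  | ComplexScalars => Num.conj
  end.

Definition scalar_re (R : realType) (k : scalar_kind) : scalars R k -> R :=
  match k return scalars R k -> R with
  | RealScalars => fun x => x
  | ComplexScalars => fun x => complex.Re x
  end.

(* [hdot] is linear in its first argument and conjugate-linear in its second. *)
Record hilbertSpace (R : realType) (k : scalar_kind) := HilbertSpace {
  hcarrier :> completeNormedModType (scalars R k) ;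
  hdot : {dot hcarrier for @scalar_conj R k} ;
  hdotE : forall x : hcarrier, `|x| ^+ 2 = hdot x x
}.

(* The library norm takes its values in the field of scalars; the following
   one takes them in [R]. *)
Definition rnorm (R : realType) (k : scalar_kind)
    (V : normedZmodType (scalars R k)) (x : V) : R := scalar_re `|x|.

Definition bessel (R : realType) (k : scalar_kind) (H : hilbertSpace R k)
    (I : choiceType) (u : I -> H) (B : R) : Prop :=
  forall f : H,
    (\esum_(i in [set: I]) (rnorm (hdot H f (u i)) ^+ 2)%:E
       <= (B * rnorm f ^+ 2)%:E)%E.

(* [{u_i}_{i \in J}] is a Riesz sequence with bounds [A] and [B]; only the
   values of [c] on [J] matter, and both sums over [J] are finite sums. *)
Definition riesz_sequence (R : realType) (k : scalar_kind)
    (H : hilbertSpace R k) (I : choiceType) (J : set I) (u : I -> H)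
    (A B : R) : Prop :=
  0 < A /\
  forall c : I -> scalars R k, finite_set (J `&` [set i | c i != 0]) ->
    A * (\sum_(i \in J) rnorm (c i) ^+ 2)
      <= rnorm (\sum_(i \in J) c i *: u i) ^+ 2
      <= B * (\sum_(i \in J) rnorm (c i) ^+ 2).

(* Main.v *)
(* Subtracting the identity from the Gram matrices of the systems gives matrices
   T = +(G - 1) and T = -(G - 1), one block for each system and sign, which are
   Hermitian, have zero diagonal and norm O(max B_j), and whose rows have
   squared norm at most B_j - 1.  We look for a selector s for which the
   restriction of each block to s is at most e times the identity.

   The polynomial det(diag(z) - T) is multi-affine and real stable.  Setting all
   variables of a group J_l (over all blocks) to z_l and averaging over the
   elements i of J_l the terms that keep only i amounts to applying first order
   differential operators, so it preserves real stability.  A barrier argument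
   then shows that the average is positive at the point whose coordinates are all
   e.  The Rayleigh inequalities of stable polynomials allow us to replace the
   average over a group by a single one of its elements, and then to discard all
   blocks but one.  Hence all principal minors of e - T, restricted to s and to a
   block, are positive, so that the largest eigenvalue is at most e.  Only
   sum_j (B_j - 1) enters the size required of the groups, and the selector for
   infinite index sets is an ultrafilter limit of selectors for finite ones. *)

Require Import Defs.
From mathcomp Require Import all_boot all_order all_algebra.
From mathcomp Require Import boolp complex cauchyreals zify ring lra.

Set Implicit Arguments.
Unset Strict Implicit.
Unset Printing Implicit Defensive.

Import Order.TTheory GRing.Theory Num.Theory.

Local Open Scope ring_scope.

(** * Polynomials without zeros in the upper half-plane *)

(** The number of systems is unbounded, so no estimate may depend on the number of blocks. This is
    why a group is not kept as a product over its blocks: the role [Single] makes the polynomial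
    affine in z_l, and the blocks contribute additively to its constant term, each by a bound
    proportional to the row bound B_j - 1, which is summable.

    The barrier starts at a large point u, at least twice the norm of T. Passing from [Full] to
    [Single] keeps only the two top coefficients of a polynomial in z_l, and the root of what
    remains is w times the sum of the old roots. Hence the coordinate can drop from the large u to
    the small x = e in one step, at the price of a margin 2 u w, where w = 1 / #Q for groups of #Q
    candidates. Balancing the two costs leads to u = 8 (1 + sum (B_j - 1)) / e and to groups of size
    4 u / e.

    Up to the Gram matrices everything takes place over a real closed field. Limits at the boundary
    of the half-plane are taken along polynomials in one real parameter, and explicit lower bounds
    keep such limits away from 0. *)

Section ComplexParts.
Variable R : rcfType.
Implicit Types x y : R[i].

Local Notation Re := (@complex.Re R).
Local Notation Im := (@complex.Im R).
Local Notation conj := (@conjc R).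

Lemma eqcP x y : Re x = Re y -> Im x = Im y -> x = y.
Proof. by case: x y => [a b] [c d] /= -> ->. Qed.

Lemma ReD x y : Re (x + y) = Re x + Re y. Proof. by case: x y => [a b] [c d]. Qed.
Lemma ImD x y : Im (x + y) = Im x + Im y. Proof. by case: x y => [a b] [c d]. Qed.
Lemma ReN x : Re (- x) = - Re x. Proof. by case: x. Qed.
Lemma ImN x : Im (- x) = - Im x. Proof. by case: x. Qed.
Lemma ReM x y : Re (x * y) = Re x * Re y - Im x * Im y.
Proof. by case: x y => [a b] [c d]. Qed.
Lemma ImM x y : Im (x * y) = Re x * Im y + Im x * Re y.
Proof. by case: x y => [a b] [c d]. Qed.
Lemma Re_conj x : Re (conj x) = Re x. Proof. by case: x. Qed.
Lemma Im_conj x : Im (conj x) = - Im x. Proof. by case: x. Qed.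
Lemma Re_real (a : R) : Re a%:C%C = a. Proof. by []. Qed.
Lemma Im_real (a : R) : Im a%:C%C = 0. Proof. by []. Qed.
Lemma Re_sum (I : Type) (r : seq I) (P : pred I) (F : I -> R[i]) :
  Re (\sum_(i <- r | P i) F i) = \sum_(i <- r | P i) Re (F i).
Proof. by apply: (big_morph Re ReD). Qed.
Lemma Im_sum (I : Type) (r : seq I) (P : pred I) (F : I -> R[i]) :
  Im (\sum_(i <- r | P i) F i) = \sum_(i <- r | P i) Im (F i).
Proof. by apply: (big_morph Im ImD). Qed.

Definition cE := (ReD, ImD, ReN, ImN, ReM, ImM, Re_conj, Im_conj, Re_real, Im_real).

Lemma conjcM x y : conj (x * y) = conj x * conj y. Proof. exact: rmorphM. Qed.
Lemma conjcX x n : conj (x ^+ n) = conj x ^+ n. Proof. exact: rmorphXn. Qed.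

Lemma real_complexX (a : R) n : (a ^+ n)%:C%C = a%:C%C ^+ n. Proof. exact: rmorphXn. Qed.
Lemma real_complexM (a b : R) : (a * b)%:C%C = a%:C%C * b%:C%C. Proof. exact: rmorphM. Qed.
Lemma Im_mulr_real x (a : R) : Im (x * a%:C%C) = Im x * a.
Proof. by rewrite ImM Re_real Im_real mulr0 add0r. Qed.

Lemma conjcM_re x : x * conj x = (Re x ^+ 2 + Im x ^+ 2)%:C%C.
Proof. by apply: eqcP; rewrite !cE; ring. Qed.

Lemma sqnorm_eq0 x : (Re x ^+ 2 + Im x ^+ 2 == 0) = (x == 0).
Proof. by rewrite eq_complex paddr_eq0 ?sqr_ge0 // !sqrf_eq0. Qed.

Lemma sqnorm_gt0 x : x != 0 -> 0 < Re x ^+ 2 + Im x ^+ 2.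
Proof. by move=> x0; rewrite lt0r sqnorm_eq0 x0 addr_ge0 ?sqr_ge0. Qed.

Lemma Im_div x y : y != 0 ->
  Im (x / y) = Im (x * conj y) / (Re y ^+ 2 + Im y ^+ 2).
Proof.
move=> y0; have n0 := sqnorm_gt0 y0.
have -> : x / y = x * conj y * ((Re y ^+ 2 + Im y ^+ 2)^-1)%:C%C.
  apply: (mulIf y0); rewrite divfK //.
  rewrite [RHS](_ : _ = x * (y * conj y * ((Re y ^+ 2 + Im y ^+ 2)^-1)%:C%C)).
    by rewrite conjcM_re -rmorphM /= mulfV ?gt_eqF // rmorph1 mulr1.
  by ring.
by rewrite ImM Re_real Im_real mulr0 add0r.
Qed.

Lemma horner_re (p : {poly R[i]}) (t : R) :
  Re p.[t%:C%C] = (map_poly Re p).[t].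
Proof.
rewrite horner_coef Re_sum (horner_coef_wide _ (size_poly _ _)).
apply: eq_bigr => i _; rewrite coef_map_id0 // -rmorphXn /= !cE; ring.
Qed.

(** Continuity at 0 in algebraic form, valid over any real closed field. It carries inequalities
    from the open upper half-plane to its boundary. *)
Lemma horner_re_ge0 (p : {poly R[i]}) :
  (forall t : R, 0 < t -> 0 <= Re p.[t%:C%C]) -> 0 <= Re p.[0].
Proof.
move=> H; rewrite -(rmorph0 (real_complex R)) horner_re.
have {}H t : 0 < t -> 0 <= (map_poly Re p).[t] by move=> /H; rewrite horner_re.
move: (map_poly Re p) H => {p} q H; rewrite leNgt; apply/negP => q0.
have /factor_theorem[u uE] : root (q - q.[0]%:P) 0 by rewrite /root !hornerE subrr.
have qE : q = q.[0]%:P + u * 'X by rewrite -(subr0 'X) -uE addrC subrK.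
have B0 := poly_bound_gt0 u 0 1; set B := poly_bound u 0 1 in B0.
(* [B] bounds |u| on [-1, 1], so at this t the term u(t) t is at most half of - q(0) and the value
   of q stays negative. *)
pose t := Num.min 1 (- q.[0] / (2 * B)).
have t0 : 0 < t by rewrite lt_min ltr01 divr_gt0 ?oppr_gt0 // mulr_gt0.
have := H t t0; rewrite qE !hornerE => H1.
have t1 : t <= 1 by rewrite ge_min lexx.
have tq : t <= - q.[0] / (2 * B) by rewrite ge_min lexx orbT.
have ub : `|u.[t]| <= B by apply: poly_boundP; rewrite subr0 gtr0_norm.
have : u.[t] * t <= B * t by rewrite ler_wpM2r ?(ltW t0) // (le_trans (ler_norm _)).
have : B * t <= - q.[0] / 2.
  apply: (le_trans (ler_wpM2l (ltW B0) tq)).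
  by rewrite le_eqVlt; apply/orP; left; apply/eqP; field; rewrite gt_eqF.
lra.
Qed.

Lemma horner_im_le0 (p : {poly R[i]}) :
  (forall t : R, 0 < t -> Im p.[t%:C%C] <= 0) -> Im p.[0] <= 0.
Proof.
move=> H; have iE x : Re ('i%C * x) = - Im x by rewrite ReM /= mul0r mul1r sub0r.
have := @horner_re_ge0 ('i%C *: p); rewrite hornerZ iE oppr_ge0; apply=> t t0.
by rewrite hornerZ iE oppr_ge0 H.
Qed.

(* The m-th roots of z sum to 0 and none of them is real. *)
Lemma root_upper (m : nat) (z : R[i]) : (1 < m)%N -> Im z != 0 ->
  exists w : R[i], 0 < Im w /\ w ^+ m = z.
Proof.
move=> m1 z0; have mgt0 : (0 < m)%N by apply: ltnW.
have [L LE] := closed_field_poly_normal ('X^m - z%:P).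
have lc : lead_coef ('X^m - z%:P) = 1.
  by apply/monicP; rewrite monicXnsubC.
rewrite lc scale1r in LE.
have sL : size L = m.
  by have := size_prod_XsubC L id; rewrite -LE size_XnsubC // => -[].
have rt w : w \in L -> w ^+ m = z.
  move=> wL; have : root ('X^m - z%:P) w by rewrite LE root_prod_XsubC.
  by rewrite /root !hornerE subr_eq0 => /eqP.
have s0 : \sum_(w <- L) w = 0.
  have := coefPn_prod_XsubC (ps := L); rewrite sL -lt0n => /(_ mgt0).
  rewrite -LE coefB coefXn coefC.
  have -> : (m.-1 == m) = false by rewrite ltn_eqF // ltn_predL.
  have -> : (m.-1 == 0%N) = false by case: (m) m1 => [|[|]].
  by rewrite subr0 => /eqP; rewrite eq_sym oppr_eq0 => /eqP.
have [/hasP[w wL wi]|/hasPn Hn] := boolP (has (fun w => 0 < Im w) L).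
  by exists w; split=> //; apply: rt.
exfalso; have neg w : w \in L -> Im w < 0.
  move=> wL; have := Hn w wL; rewrite -leNgt le_eqVlt => /orP[/eqP i0|//].
  have wr : w = (Re w)%:C%C by apply: eqcP; rewrite //= i0.
  by have := rt w wL; rewrite wr -rmorphXn /= => zE; rewrite -zE eqxx in z0.
have : Im (\sum_(w <- L) w) < 0.
  rewrite Im_sum; case: L sL {LE rt s0 Hn} neg => [|w L] sL neg.
    by rewrite -sL in mgt0.
  rewrite big_cons -[ltRHS]addr0 ltr_leD ?neg ?mem_head //.
  rewrite big_seq; apply: sumr_le0 => v vL; apply/ltW/neg.
  by rewrite in_cons vL orbT.
by rewrite s0 ltxx.
Qed.

(** * Rational functions mapping the upper half-plane to the lower one *)

Definition pC (p : {poly R}) : {poly R[i]} := map_poly (real_complex R) p.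

Lemma horner_pC p (t : R) : (pC p).[t%:C%C] = p.[t]%:C%C.
Proof. by rewrite /pC horner_map. Qed.

(** The sign of Im (p / q) on the upper half-plane, multiplied by |q|^2 so that q may vanish. *)
Definition lower_im (p q : {poly R}) := forall z : R[i], 0 < Im z ->
  Im ((pC p).[z] * conj (pC q).[z]) <= 0.

Definition monic_of (L : seq R) : {poly R} := \prod_(l <- L) ('X - l%:P).

(** Let m be the multiplicity of l. Along z = l + t w with t -> 0, the quotient behaves like a
    positive multiple of v / w ^ m with v = p(l) P2(l), so v Im (w ^ m) >= 0 for all w in the upper
    half-plane. If m > 1, some such w has w ^ m = - i v, a contradiction. Hence m = 1, and w = i
    gives v >= 0. *)
Lemma local_sign (L : seq R) (p : {poly R}) l : l \in L -> p.[l] != 0 ->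
  lower_im p (monic_of L) ->
  l \notin rem l L /\ 0 <= p.[l] * (monic_of (rem l L)).[l].
Proof.
move=> lL pl0 H; pose P2 := \prod_(x <- L | x != l) ('X - x%:P).
pose m := count_mem l L.
have m0 : (0 < m)%N by rewrite -has_count has_pred1.
have PE : monic_of L = ('X - l%:P) ^+ m * P2.
  rewrite /monic_of (bigID (fun x : R => x == l)) /=; congr (_ * _).
  rewrite (eq_bigr (fun=> 'X - l%:P)); last by move=> x /eqP ->.
  by rewrite big_const_seq iter_mulr_1.
have P2l : P2.[l] != 0.
  rewrite /P2 horner_prod prodf_seq_neq0; apply/allP => x _ /=.
  by apply/implyP => xl; rewrite !hornerE subr_eq0 eq_sym.
set v := p.[l] * P2.[l].
have v0 : v != 0 by rewrite mulf_neq0.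
have key (w : R[i]) : 0 < Im w -> 0 <= v * Im (w ^+ m).
  move=> w0; pose c := w *: 'X + (l%:C%C)%:P.
  (* Along the ray, p times the conjugate of the denominator, with the vanishing factor t ^ m
     divided out. *)
  pose f := (pC p \Po c) * map_poly conj (pC P2 \Po c) * (conj w ^+ m)%:P.
  have fE (t : R) : f.[t%:C%C] =
      (pC p).[l%:C%C + w * t%:C%C] * conj (pC P2).[l%:C%C + w * t%:C%C]
       * conj w ^+ m.
    rewrite /f !hornerM !hornerC horner_comp; congr (_ * _ * _).
      by rewrite /c !hornerE addrC.
    rewrite -[X in (map_poly _ _).[X]](conjc_real t) horner_map /= horner_comp.
    by rewrite /c !hornerE addrC.
  have : Im f.[0] <= 0.
    apply: horner_im_le0 => t t0; rewrite fE.
    set z := l%:C%C + w * t%:C%C.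
    have z0 : 0 < Im z by rewrite /z !cE; nra.
    have := H z z0; rewrite PE /pC rmorphM rmorphXn /= hornerM horner_exp.
    rewrite map_polyXsubC !hornerE.
    have -> : z - (l%:C)%C = w * t%:C%C by rewrite /z addrC addKr.
    rewrite conjcM conjcX conjcM conjc_real exprMn.
    set u1 := (map_poly _ p).[z]; set u2 := conj _.[z].
    have -> : u1 * (conj w ^+ m * t%:C%C ^+ m * u2) =
              u1 * u2 * conj w ^+ m * t%:C%C ^+ m by ring.
    by rewrite -real_complexX Im_mulr_real pmulr_lle0 // exprn_gt0.
  rewrite -[X in f.[X]](rmorph0 (real_complex R)) fE rmorph0 mulr0 addr0.
  rewrite !horner_pC conjc_real -real_complexM -conjcX -/v mulrC Im_mulr_real.
  by rewrite Im_conj mulNr oppr_le0 mulrC.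
have m1 : m = 1%N.
  apply/eqP; rewrite eqn_leq m0 andbT leqNgt; apply/negP => m2.
  have [|w [w0 wE]] := @root_upper m ((0 : R) +i* (- v))%C m2.
    by rewrite /= oppr_eq0.
  have := key w w0; rewrite wE /= mulrN oppr_ge0.
  by rewrite leNgt -expr2 exprn_even_gt0 // v0.
have vn : 0 <= v by have := key 'i%C ltr01; rewrite m1 expr1 /= mulr1.
have nl : l \notin rem l L.
  by rewrite -has_pred1 has_count count_rem -/m lL m1 /= eqxx.
split=> //; suff -> : monic_of (rem l L) = P2 by [].
have lN : 'X - l%:P != 0 :> {poly R} by rewrite polyXsubC_eq0.
apply: (mulfI lN); have := PE; rewrite m1 expr1 => <-.
by rewrite /monic_of (perm_big _ (perm_to_rem lL)) big_cons.
Qed.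

Definition psum (s : seq (R * R)) (t : R) := \sum_(x <- s) x.2 / (t - x.1).

(* Induction on the number of common roots, which cancel.  Without common roots
   the roots of the denominator are simple by [local_sign], and the numerator is
   its Lagrange interpolation. *)
Lemma partial_fractions (L : seq R) (p : {poly R}) : (size p <= size L)%N ->
  lower_im p (monic_of L) ->
  exists s : seq (R * R),
    [/\ forall x : R * R, x \in s -> x.1 \in L /\ 0 <= x.2,
        forall t, t \notin L -> p.[t] = (monic_of L).[t] * psum s t
      & p`_(size L).-1 = \sum_(x <- s) x.2].
Proof.
have [n] := ubnP (size L); elim: n => // n IH in L p *; rewrite ltnS => sn sp H.
have [/hasP[l lL pl]|/hasPn nr] := boolP (has (root p) L).
  have /factor_theorem[p1 pE] := pl.
  have LE : monic_of L = monic_of (rem l L) * ('X - l%:P).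
    by rewrite /monic_of (perm_big _ (perm_to_rem lL)) big_cons mulrC.
  have L0 : (0 < size L)%N by case: (L) lL.
  have sr := size_rem lL.
  have sp1 : (size p1 <= size (rem l L))%N.
    have [->|p10] := eqVneq p1 0; first by rewrite size_poly0.
    move: sp; rewrite pE size_Mmonic ?monicXsubC // size_XsubC sr addn2 /= => h.
    by rewrite -ltnS prednK.
  have [||s [s1 s2 s3]] := IH (rem l L) p1 _ sp1.
  - by rewrite sr prednK.
  - move=> z z0; have := H z z0; rewrite LE pE /pC !rmorphM /= !hornerM.
    rewrite map_polyXsubC !hornerE; set d := z - _.
    have d0 : 0 < Re d ^+ 2 + Im d ^+ 2.
      rewrite sqnorm_gt0 //; apply/eqP => /(congr1 Im); rewrite /d !cE /=.
      by move: z0; lra.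
    set u1 := (map_poly _ _).[z]; set u2 := (map_poly _ _).[z].
    rewrite rmorphM /=.
    have -> : u1 * d * (conj u2 * conj d) = u1 * conj u2 * (d * conj d) by ring.
    by rewrite conjcM_re ImM Re_real Im_real mulr0 add0r pmulr_lle0.
  exists s; split.
  - by move=> x /s1[xL x2]; split=> //; apply: mem_rem xL.
  - move=> t tL; have tr : t \notin rem l L by apply: contra tL; apply: mem_rem.
    by rewrite pE LE !hornerM (s2 _ tr); ring.
  - rewrite pE -s3 mulrBr coefB coefMX coefMC sr.
    move: sp1; rewrite sr; case: (size L) L0 => // k _ /= sp1.
    rewrite (nth_default _ sp1) mul0r subr0; case: k sp1 => [|j] //=.
    by rewrite leqn0 size_poly_eq0 => /eqP ->; rewrite coef0.
have sgn l : l \in L ->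
    l \notin rem l L /\ 0 <= p.[l] * (monic_of (rem l L)).[l].
  by move=> lL; apply: local_sign => //; have := nr l lL.
have uL : uniq L.
  apply: count_mem_uniq => l; case: (boolP (l \in L)) => [lL|/count_memPn //].
  have [/count_memPn] := sgn l lL; rewrite count_rem lL /= eqxx => c0 _.
  move: lL c0; rewrite -has_pred1 has_count => lL /eqP; rewrite subn_eq0 => c1.
  by apply/eqP; rewrite eqn_leq c1.
have monE l : l \in L -> monic_of L = ('X - l%:P) * monic_of (rem l L).
  by move=> lL; rewrite /monic_of (perm_big _ (perm_to_rem lL)) big_cons.
have mon_root l (x : R) : x \in rem l L -> (monic_of (rem l L)).[x] = 0.
  by move=> xL; apply/eqP; rewrite -/(root _ _) root_prod_XsubC.
have mon_nz l : l \in L -> (monic_of (rem l L)).[l] != 0.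
  by move=> lL; rewrite -/(root _ _) root_prod_XsubC; have [] := sgn l lL.
pose c l := p.[l] / (monic_of (rem l L)).[l].
pose q := \sum_(l <- L) c l *: monic_of (rem l L).
have size_mon l : l \in L -> size (monic_of (rem l L)) = size L.
  move=> lL; rewrite size_prod_XsubC size_rem // prednK //.
  by case: (L) lL.
have pq : p = q.
  apply/eqP; rewrite -subr_eq0; apply/eqP.
  apply: (roots_geq_poly_eq0 (rs := L)) => //.
    apply/allP => x xL; rewrite /root !hornerE /q horner_sum.
    rewrite (bigD1_seq x) //= big_seq_cond big1 => [|l /andP[lL lx]].
      by rewrite addr0 hornerZ /c divfK ?subrr // mon_nz.
    by rewrite hornerZ mon_root ?mulr0 // mem_rem_uniq // inE eq_sym lx.
  rewrite (leq_trans (size_polyD _ _)) // geq_max sp size_polyN /q.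
  rewrite (leq_trans (size_sum _ _ _)) //; apply/bigmax_leqP_seq => l lL _.
  by rewrite (leq_trans (size_scale_leq _ _)) // size_mon.
exists [seq (l, c l) | l <- L]; split.
- move=> _ /mapP[l lL ->] /=; split=> //; have [_] := sgn l lL.
  rewrite /c; have := mon_nz l lL; set v := (monic_of _).[l] => v0 pv.
  rewrite -(pmulr_lge0 _ (_ : 0 < v ^+ 2)) ?exprn_even_gt0 //.
  by rewrite (_ : _ * v ^+ 2 = p.[l] * v) //; field.
- move=> t tL; rewrite {1}pq /q horner_sum /psum big_map mulr_sumr.
  apply: eq_big_seq => l lL; rewrite hornerZ (monE l lL) hornerM hornerXsubC /=.
  have tl : t - l != 0 by rewrite subr_eq0; apply: contraNneq tL => ->.
  by move: (t - l) tl (monic_of _).[t] (c l) => x x0 u v; field.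
- rewrite pq /q coef_sum big_map; apply: eq_big_seq => l lL /=.
  have := lead_coef_prod_XsubC (rem l L) predT id.
  by rewrite lead_coefE -/(monic_of _) size_mon // coefZ => ->; rewrite mulr1.
Qed.

Lemma real_roots (P : {poly R}) (d : nat) : size P = d.+1 ->
  (forall z : R[i], 0 < Im z -> (pC P).[z] != 0) ->
  exists L : seq R, size L = d /\ P = P`_d *: monic_of L.
Proof.
move=> sP H; have [Z ZE] := closed_field_poly_normal (pC P).
have lP : lead_coef (pC P) = (P`_d)%:C%C.
  by rewrite lead_coef_map lead_coefE sP.
have c0 : lead_coef (pC P) != 0 by rewrite lead_coef_eq0 map_poly_eq0 -size_poly_eq0 sP.
have im0 z : z \in Z -> Im z = 0.
  move=> zZ; have rz : root (pC P) z by rewrite ZE rootZ // root_prod_XsubC.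
  apply/eqP; rewrite eq_le; apply/andP; split; rewrite leNgt; apply/negP => zi.
    by move: (H z zi); rewrite -/(root _ z) rz.
  have := H (conj z); rewrite Im_conj oppr_gt0 => /(_ zi).
  rewrite -/(root _ (conj z)) -complex_root_conj.
  suff -> : map_poly conj (pC P) = pC P by rewrite rz.
  by rewrite /pC -map_poly_comp; apply: eq_map_poly => t /=; rewrite oppr0.
have sZ : size Z = d.
  apply: succn_inj; rewrite -sP -(size_map_poly (real_complex R) P) -/(pC P) ZE.
  by rewrite size_scale // size_prod_XsubC.
exists [seq Re z | z <- Z]; split; first by rewrite size_map.
apply: (map_poly_inj (real_complex R)); rewrite -/(pC P) ZE lP.
rewrite map_polyZ /monic_of rmorph_prod big_map /=; congr (_ *: _).
apply: eq_big_seq => z zZ; rewrite map_polyXsubC; congr ('X - _%:P).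
by apply: eqcP; rewrite //= im0.
Qed.

(** What the role [Single] makes of a polynomial q of degree d in the variable of a group. For w = 1
    / d it is the derivative of order d - 1 of q at x, divided by d!. *)
Definition top2 (x w : R) (d : nat) (q : {poly R}) := x * q`_d + w * q`_d.-1.

(** Partial fractions write p / P as a constant plus a sum of r / (t - l) with r >= 0 and -a < l <
    a. Among |t| >= a each term is largest at t = a, whence the second claim. For the third, the
    hypothesis makes [top2 x w d P] at least 2 a w times the leading coefficient, while the sum of
    the r is at most 2 a times the sum of the r / (a - l), because a - l <= 2 a. *)
Lemma nevanlinna_compare (P p : {poly R}) (d : nat) (a : R) :
  (0 < d)%N -> size P = d.+1 -> 0 < P`_d -> (size p <= d.+1)%N ->
  (forall z : R[i], 0 < Im z -> (pC P).[z] != 0) -> lower_im p P ->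
  0 < a -> (forall t, a <= `|t| -> P.[t] != 0) ->
  [/\ 0 < P.[a],
      forall t, a <= `|t| -> p.[t] / P.[t] <= p.[a] / P.[a]
    & forall x w : R, 0 < w -> 2 * a * w * P`_d <= top2 x w d P ->
        top2 x w d p * P.[a] <= top2 x w d P * p.[a]].
Proof.
move=> d0 sP c0 sp HP Hp a0 Pa.
have [L [sL PE]] := real_roots sP HP; set c := P`_d in c0 PE *.
have Pt t : P.[t] = c * (monic_of L).[t] by rewrite PE hornerZ.
have La l : l \in L -> - a < l < a.
  move=> lL; rewrite -ltr_norml ltNge; apply/negP => /Pa.
  by rewrite Pt mulf_eq0 negb_or -/(root _ _) root_prod_XsubC lL andbF.
have lc : (monic_of L)`_d = 1.
  by apply: (@mulfI _ c); rewrite ?gt_eqF // mulr1 -coefZ -PE.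
pose K := p`_d / c; pose p1 := p - K *: P.
have sp1 : (size p1 <= size L)%N.
  rewrite sL; apply/leq_sizeP => j; rewrite leq_eqVlt => /orP[/eqP <-|dj].
    by rewrite coefB coefZ -/c /K divfK ?subrr // gt_eqF.
  by rewrite coefB coefZ !nth_default ?mulr0 ?subr0 ?sP // (leq_trans sp).
have Hp1 : lower_im p1 (monic_of L).
  move=> z z0; have := Hp z z0; rewrite /p1 PE /pC rmorphB /= !map_polyZ !hornerE.
  set u := (map_poly _ p).[z]; set m := (map_poly _ _).[z] => h.
  rewrite mulrBl -!mulrA conjcM_re -!real_complexM ImD ImN Im_real subr0.
  move: h; rewrite conjcM conjc_real mulrCA mulrC Im_mulr_real.
  by rewrite pmulr_lle0.
have [s [s1 s2 s3]] := partial_fractions sp1 Hp1.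
have pE : p = K *: P + p1 by rewrite addrC subrK.
clearbody p1.
have tL t : a <= `|t| -> t \notin L.
  by move=> /Pa; rewrite Pt mulf_eq0 negb_or -/(root _ _) root_prod_XsubC => /andP[].
have na : a <= `|a| by rewrite ler_norm.
have pt t : a <= `|t| -> p.[t] = P.[t] * (K + psum s t / c).
  move=> ta; rewrite {1}pE hornerD hornerZ s2 ?tL // Pt.
  by field; rewrite gt_eqF.
have Pa0 : 0 < P.[a].
  rewrite Pt mulr_gt0 // /monic_of horner_prod big_seq prodr_gt0 // => l /La.
  by rewrite hornerXsubC subr_gt0 => /andP[].
have psum_le t : a <= `|t| -> psum s t <= psum s a.
  move=> ta; rewrite /psum big_seq [leRHS]big_seq; apply: ler_sum => x /s1[xL x0].
  apply: ler_wpM2l => //; have /andP[l1 l2] := La _ xL.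
  have [t0|t0] := lerP 0 t.
    rewrite ger0_norm // in ta; rewrite lef_pV2 ?posrE ?subr_gt0 //; first by lra.
    exact: lt_le_trans ta.
  rewrite ltr0_norm // in ta; apply: (@le_trans _ _ 0).
    by rewrite invr_le0; lra.
  by rewrite invr_ge0; lra.
split=> // [t ta|x w w0 hx].
  rewrite !pt // ![P.[_] * _ / _]mulrAC !mulfV ?mul1r ?(gt_eqF Pa0) ?Pa //.
  by rewrite lerD2l ler_wpM2r ?invr_ge0 ?(ltW c0) // psum_le.
have -> : top2 x w d p = K * top2 x w d P + w * \sum_(y <- s) y.2.
  rewrite /top2 {1 2}pE !coefD !coefZ -s3 sL.
  by have := nth_default 0 sp1; rewrite sL => ->; ring.
have S0 : 0 <= \sum_(y <- s) y.2 by rewrite big_seq sumr_ge0 // => y /s1[].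
set S := \sum_(y <- s) y.2 in S0 *; rewrite (pt a na).
have hS : S <= 2 * a * psum s a.
  rewrite /S /psum mulr_sumr big_seq [leRHS]big_seq; apply: ler_sum => y /s1[yL y0].
  have /andP[l1 l2] := La _ yL.
  rewrite mulrCA ler_peMr // ler_pdivlMr ?subr_gt0 // mul1r; lra.
have -> : top2 x w d P * (P.[a] * (K + psum s a / c)) =
  K * top2 x w d P * P.[a] + top2 x w d P / c * psum s a * P.[a] by ring.
rewrite mulrDl lerD2l ler_wpM2r ?(ltW Pa0) //.
have hc : 2 * a * w <= top2 x w d P / c by rewrite ler_pdivlMr.
have ps0 : 0 <= psum s a.
  rewrite /psum big_seq sumr_ge0 // => y /s1[yL y0]; have /andP[l1 l2] := La _ yL.
  by rewrite divr_ge0 // subr_ge0 ltW.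
apply: (le_trans _ (ler_wpM2r ps0 hc)).
by rewrite [leRHS](_ : _ = w * (2 * a * psum s a)) ?ler_wpM2l ?(ltW w0) //; ring.
Qed.

Lemma lower_roots (p : {poly R[i]}) (d : nat) : (size p <= d.+1)%N -> p`_d != 0 ->
  (forall z, 0 < Im z -> p.[z] != 0) ->
  exists Z : seq R[i], [/\ size Z = d, p = p`_d *: \prod_(z <- Z) ('X - z%:P)
    & forall z, z \in Z -> Im z <= 0].
Proof.
move=> sp pd H; have sp' : size p = d.+1.
  apply/eqP; rewrite eqn_leq sp ltnNge; apply: contra pd => pd.
  by rewrite nth_default.
have [Z ZE] := closed_field_poly_normal p.
have lE : lead_coef p = p`_d by rewrite lead_coefE sp'.
exists Z; split; rewrite -?lE //.
  have := congr1 (fun q : {poly R[i]} => size q) ZE.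
  by rewrite size_scale ?lE // size_prod_XsubC sp' => -[].
move=> z zZ; rewrite leNgt; apply/negP => /H; rewrite -/(root _ _) ZE rootZ ?lE //.
by rewrite root_prod_XsubC zZ.
Qed.

(* The roots of p and hence their mean are in the closed lower half-plane. *)
Lemma top2_neq0 (p : {poly R[i]}) (d : nat) (w : R) z : (0 < d)%N ->
  (size p <= d.+1)%N -> p`_d != 0 -> (forall z, 0 < Im z -> p.[z] != 0) ->
  0 < w -> 0 < Im z -> z * p`_d + w%:C%C * p`_d.-1 != 0.
Proof.
move=> d0 sp pd H w0 z0; have [Z [sZ pE Zi]] := lower_roots sp pd H.
have -> : p`_d.-1 = - p`_d * \sum_(x <- Z) x.
  have := coefPn_prod_XsubC (ps := Z); rewrite sZ -lt0n => /(_ d0) h.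
  by rewrite {1}pE coefZ h mulrN mulNr.
have -> : z * p`_d + w%:C%C * (- p`_d * \sum_(x <- Z) x) =
   p`_d * (z - \sum_(x <- Z) x * w%:C%C) by rewrite -mulr_suml; ring.
rewrite mulf_neq0 //; apply/eqP => /(congr1 Im); rewrite ImD ImN Im_sum /=.
apply/eqP; rewrite gt_eqF // ltr_wpDr // oppr_ge0 big_seq.
by apply: sumr_le0 => x /Zi xi; rewrite Im_mulr_real mulr_le0_ge0 // ltW.
Qed.

Definition sqn x := Re x ^+ 2 + Im x ^+ 2.

Lemma sqnM x y : sqn (x * y) = sqn x * sqn y.
Proof. by rewrite /sqn !cE; ring. Qed.

(** Every root lies in the closed lower half-plane, so each factor has modulus at least Im z. Unlike
    mere nonvanishing, this bound survives a passage to the limit. *)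
Lemma horner_lower_bound (p : {poly R[i]}) (d : nat) z :
  (size p <= d.+1)%N -> p`_d != 0 -> (forall z, 0 < Im z -> p.[z] != 0) ->
  0 < Im z -> sqn p`_d * Im z ^+ d.*2 <= sqn p.[z].
Proof.
move=> sp pd H z0; have [Z [sZ pE Zi]] := lower_roots sp pd H.
rewrite {2}pE hornerZ sqnM ler_wpM2l ?addr_ge0 ?sqr_ge0 // -sZ.
elim: (Z) Zi => [|x X IH] Zi; first by rewrite big_nil hornerC /sqn /= expr0 expr1n expr0n addr0.
rewrite big_cons hornerM hornerXsubC sqnM /= doubleS !exprS mulrA.
rewrite ler_pM ?mulr_ge0 ?exprn_ge0 ?(ltW z0) //; last first.
  by apply: IH => y yX; apply: Zi; rewrite in_cons yX orbT.
have xi := Zi x (mem_head _ _).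
rewrite /sqn !cE ler_wpDl ?sqr_ge0 // expr2.
by rewrite ler_pM ?(ltW z0) // lerDl oppr_ge0.
Qed.

End ComplexParts.

(** * Stability, the barrier argument and Rayleigh inequalities *)

Definition upd (I : eqType) (T : Type) (f : I -> T) (i : I) (v : T) : I -> T :=
  fun j => if j == i then v else f j.

Lemma updE (I : eqType) (T : Type) (f : I -> T) i v : upd f i v i = v.
Proof. by rewrite /upd eqxx. Qed.

Lemma updN (I : eqType) (T : Type) (f : I -> T) i v j : j != i -> upd f i v j = f j.
Proof. by rewrite /upd => /negPf ->. Qed.

Lemma upd_upd (I : eqType) (T : Type) (f : I -> T) i u v :
  upd (upd f i u) i v = upd f i v.
Proof. by apply/funext => j; rewrite /upd; case: eqP. Qed.

Lemma updC (I : eqType) (T : Type) (f : I -> T) i j u v : i != j ->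
  upd (upd f i u) j v = upd (upd f j v) i u.
Proof.
move=> ij; apply/funext => x; rewrite /upd; have [->|//] := eqVneq x j.
by rewrite eq_sym (negPf ij).
Qed.

Lemma upd_id (I : eqType) (T : Type) (f : I -> T) i : upd f i (f i) = f.
Proof. by apply/funext => x; rewrite /upd; case: eqP => [->|]. Qed.

(* The variables z_e are grouped, all those of a group l being set to the same
   value.  The role of a group in the polynomial is [Full] (all its elements are
   present), [Layer q] (the coefficient of the terms omitting exactly q of its
   variables; [Layer 0] amounts to removing the group), or [Single] (the sum over
   the elements of the group of the terms where only this element is present). *)
Variant role := Layer of nat | Full | Single.

Definition is_single r := if r is Single then true else false.
Definition is_layer r := if r is Layer q then (0 < q)%N else false.

Section MixedPolynomial.
Variables L F : finType.
Local Notation sel := {ffun L -> {set F}}.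

Definition weight (K : comNzRingType) (A : {set F}) (r : role) (w z : K)
    (S : {set F}) : K :=
  match r with
  | Layer q => ((S \subset A) && (#|S| == q))%:R
  | Full => if S \subset A then z ^+ (#|A| - #|S|) else 0
  | Single => if S == set0 then z else ((S \subset A) && (#|S| == 1%N))%:R * w
  end.

(** [y l] is the set of variables of group l absent from the monomial, so that [Layer 0] is a
    leading coefficient. The ring is arbitrary because real, complex and polynomial arguments all
    occur. *)
Definition mixed (K : comNzRingType) (a : sel -> K) (A : L -> {set F})
    (k : L -> role) (w z : L -> K) : K :=
  \sum_(y : sel) a y * \prod_l weight (A l) (k l) (w l) (z l) (y l).

Lemma rmorph_mixed (K K' : comNzRingType) (f : {rmorphism K -> K'}) a A k w z :
  f (mixed a A k w z) = mixed (f \o a) A k (f \o w) (f \o z).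
Proof.
rewrite /mixed rmorph_sum; apply: eq_bigr => y _; rewrite rmorphM rmorph_prod.
congr (_ * _); apply: eq_bigr => l _; rewrite /weight /=; case: (k l) => [q||].
- by rewrite rmorph_nat.
- by case: ifP; rewrite ?rmorphXn ?rmorph0.
- by case: ifP; rewrite ?rmorphM ?rmorph_nat.
Qed.

Section OneGroup.
Variables (K : comNzRingType) (a : sel -> K) (A : L -> {set F}).
Implicit Types (k : L -> role) (w z : L -> K) (l : L).

Lemma mixed_at k w z l r s : mixed a A (upd k l r) w (upd z l s) =
  \sum_(y : sel) a y * weight (A l) r (w l) s (y l) *
    \prod_(i | i != l) weight (A i) (k i) (w i) (z i) (y i).
Proof.
apply: eq_bigr => y _; rewrite (bigD1 l) //= !updE mulrA; congr (_ * _).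
by apply: eq_bigr => i il; rewrite !updN.
Qed.

Lemma mixed_layer k w z l q s :
  mixed a A (upd k l (Layer q)) w (upd z l s) = mixed a A (upd k l (Layer q)) w z.
Proof. by rewrite -[in RHS](upd_id z l) !mixed_at. Qed.

Lemma mixed_single k w z l s : mixed a A (upd k l Single) w (upd z l s) =
  s * mixed a A (upd k l (Layer 0)) w z + w l * mixed a A (upd k l (Layer 1)) w z.
Proof.
rewrite -(mixed_layer _ _ _ _ _ s) -(mixed_layer _ _ _ _ 1 s) !mixed_at !mulr_sumr.
rewrite -big_split /=; apply: eq_bigr => y _; set p := \prod_(i | _) _.
have [->|S0] := eqVneq (y l) set0.
  by rewrite sub0set cards0 /=; ring.
by rewrite cards_eq0 (negPf S0) andbF /=; ring.
Qed.

Definition group_poly k w z l : {poly K} :=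
  \sum_(q < #|A l|.+1) mixed a A (upd k l (Layer q)) w z *: 'X^(#|A l| - q).

Lemma mixed_full k w z l s :
  mixed a A (upd k l Full) w (upd z l s) = (group_poly k w z l).[s].
Proof.
rewrite horner_sum mixed_at.
under [RHS]eq_bigr => q _ do
  rewrite hornerZ hornerXn -(mixed_layer _ _ _ _ _ s) mixed_at mulr_suml.
rewrite exchange_big /=; apply: eq_bigr => y _.
set p := \prod_(i | _) _; case: ifPn => yA /=; last first.
  by rewrite big1 ?mulr0 ?mul0r // => q _; rewrite ?mulr0n !(mulr0, mul0r).
have yc : (#|y l| < #|A l|.+1)%N by rewrite ltnS subset_leq_card.
rewrite (bigD1 (Ordinal yc)) //= eqxx big1 ?addr0 => [|q qy].
  by rewrite mulr1 -!mulrA; congr (_ * _); rewrite mulrC.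
have -> : (#|y l| == q) = false; last by rewrite ?mulr0n !(mulr0, mul0r).
by apply: contra_neqF qy => /eqP yq; apply: val_inj.
Qed.

Lemma size_group_poly k w z l : (size (group_poly k w z l) <= #|A l|.+1)%N.
Proof.
apply: (leq_trans (size_sum _ _ _)); apply/bigmax_leqP => q _.
by rewrite (leq_trans (size_scale_leq _ _)) // size_polyXn ltnS leq_subr.
Qed.

Lemma coef_group_poly k w z l q : (q <= #|A l|)%N ->
  (group_poly k w z l)`_(#|A l| - q) = mixed a A (upd k l (Layer q)) w z.
Proof.
move=> qA; rewrite coef_sum (bigD1 (Ordinal (qA : (q < #|A l|.+1)%N))) //=.
rewrite coefZ coefXn eqxx mulr1 big1 ?addr0 // => i iq; rewrite coefZ coefXn.
have -> : (#|A l| - q == #|A l| - i)%N = false; last by rewrite mulr0.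
have iA : (i <= #|A l|)%N by rewrite -ltnS.
apply: contra_neqF iq => /eqP e; apply: val_inj => /=.
by rewrite -(subKn iA) -e subKn.
Qed.

Lemma group_poly_lead k w z l :
  (group_poly k w z l)`_#|A l| = mixed a A (upd k l (Layer 0)) w z.
Proof. by have := @coef_group_poly k w z l 0 isT; rewrite subn0. Qed.

Lemma group_poly_next k w z l : (0 < #|A l|)%N ->
  (group_poly k w z l)`_#|A l|.-1 = mixed a A (upd k l (Layer 1)) w z.
Proof. by move=> A0; rewrite -subn1 coef_group_poly. Qed.

End OneGroup.

Lemma map_group_poly (K K' : comNzRingType) (f : {rmorphism K -> K'}) a A k w z l :
  map_poly f (group_poly a A k w z l) = group_poly (f \o a) A k (f \o w) (f \o z) l.
Proof.
rewrite rmorph_sum; apply: eq_bigr => q _ /=.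
by rewrite map_polyZ map_polyXn /= rmorph_mixed.
Qed.

End MixedPolynomial.

Section Stability.
Variables (R : rcfType) (L F : finType) (a : {ffun L -> {set F}} -> R).
Local Notation Im := (@complex.Im R).
Local Notation conj := (@conjc R).
Local Notation toC := (real_complex R).
Local Notation aC := (toC \o a).

(** Real stability, for every choice of the sets A since these shrink during the selection. *)
Hypothesis full_neq0 : forall (A : L -> {set F}) k w (z : L -> R[i]),
  (forall l, k l = Full \/ k l = Layer 0) -> (forall l, 0 < Im (z l)) ->
  mixed aC A k w z != 0.

Variables (A : L -> {set F}) (w : L -> R).
Hypothesis w_gt0 : forall l, 0 < w l.
Local Notation mixedC k z := (mixed aC A k (toC \o w) z).

Definition admissible (k : L -> role) :=
  forall l, ~~ is_layer (k l) /\ (is_single (k l) -> (0 < #|A l|)%N).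

Lemma admissible_upd k l r : admissible k -> ~~ is_layer r ->
  (is_single r -> (0 < #|A l|)%N) -> admissible (upd k l r).
Proof. by move=> ak rl rs i; rewrite /upd; case: eqP => [->|]. Qed.

(** Induction on the number of [Single] groups. With such a group made [Full], the polynomial in its
    variable has no zero in the upper half-plane, and [top2_neq0] leads back to [Single]. *)
Lemma mixed_neq0 k z : admissible k -> (forall l, 0 < Im (z l)) -> mixedC k z != 0.
Proof.
have [n] := ubnP #|[set l | is_single (k l)]|.
elim: n => // n IH in k z *; rewrite ltnS => kn ak zi.
case: (pickP (fun l => is_single (k l))) => [l kl|ns]; last first.
  apply: full_neq0 => // l; have [] := ak l; have := ns l.
  by case: (k l) => [[|q]||] //; [right|left].
have lt r : ~~ is_single r -> (#|[set i | is_single (upd k l r i)]| < n)%N.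
  move=> rs; apply: (leq_trans _ kn); apply: proper_card; apply/properP; split.
    apply/fintype.subsetP => i; rewrite !inE /upd; case: eqP => [->|//].
    by rewrite (negPf rs).
  by exists l; rewrite !inE ?kl // updE.
have kS : k = upd k l Single by rewrite -[LHS](upd_id k l); case: (k l) kl.
have [_ /(_ kl) Al] := ak l.
rewrite kS -(upd_id z l) mixed_single -group_poly_lead -group_poly_next //.
apply: top2_neq0 => //; first exact: size_group_poly.
  by rewrite group_poly_lead IH // ?lt //; apply: admissible_upd.
move=> s s0; rewrite -mixed_full IH ?lt //; first exact: admissible_upd.
by move=> i; rewrite /upd; case: eqP.
Qed.

(** Moving all coordinates by i t presents a point of the closed half-plane as a limit of points of
    the open one, along a polynomial in t. *)
Lemma mixed_line k z : exists p : {poly R[i]},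
  forall t : R, p.[t%:C%C] = mixedC k (fun l => z l + 'i%C * t%:C%C).
Proof.
exists (mixed (fun y => (aC y)%:P) A k (fun l => (toC (w l))%:P)
          (fun l => (z l)%:P + 'i%C *: 'X)) => t.
rewrite -/(horner_eval t%:C%C _) rmorph_mixed.
by congr (mixed _ _ _ _ _); apply/funext => y; rewrite /= /horner_eval !hornerE.
Qed.

(** In the open half-plane, - w_l times the quotient of the two layers is the zero in z_l of the
    polynomial with l in role [Single], so by stability it is not in the upper half-plane. The
    boundary is reached along [mixed_line]. *)
Lemma mixed_nevanlinna k l z : admissible k -> (0 < #|A l|)%N ->
  (forall i, 0 <= Im (z i)) ->
  0 <= Im (mixedC (upd k l (Layer 1)) z * conj (mixedC (upd k l (Layer 0)) z)).
Proof.
move=> ak Al zi.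
have upper v : (forall i, 0 < Im (v i)) ->
    0 <= Im (mixedC (upd k l (Layer 1)) v * conj (mixedC (upd k l (Layer 0)) v)).
  move=> vi; set c := mixedC (upd k l (Layer 1)) v.
  have h0 : mixedC (upd k l (Layer 0)) v != 0.
    by apply: mixed_neq0 => //; apply: admissible_upd.
  set h := mixedC _ v in h0 *.
  rewrite leNgt; apply/negP => lt0.
  pose s := - ((w l)%:C%C * c / h).
  have s0 : 0 < Im s.
    rewrite /s ImN Im_div // -[_ * c * _]mulrA [_%:C%C * _]mulrC Im_mulr_real.
    by rewrite oppr_gt0 pmulr_llt0 ?invr_gt0 ?sqnorm_gt0 // nmulr_rlt0.
  have : mixedC (upd k l Single) (upd v l s) != 0.
    apply: mixed_neq0; first exact: admissible_upd.
    by move=> i; rewrite /upd; case: eqP.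
  by rewrite mixed_single -/h -/c /s mulNr divfK //= addrC subrr eqxx.
have [p1 p1E] := mixed_line (upd k l (Layer 1)) z.
have [p0 p0E] := mixed_line (upd k l (Layer 0)) z.
pose p := p1 * map_poly conj p0.
have pE t : p.[t%:C%C] = p1.[t%:C%C] * conj p0.[t%:C%C].
  by rewrite hornerM -[X in (map_poly _ _).[X]](conjc_real t) horner_map.
have : Im (- p).[0] <= 0.
  apply: horner_im_le0 => t t0; rewrite hornerN ImN oppr_le0 pE p1E p0E.
  by apply: upper => i; rewrite !cE /= mul0r mul1r add0r ltr_wpDl.
rewrite hornerN ImN oppr_le0 -[X in p.[X]](rmorph0 toC) pE p1E p0E.
by have -> : (fun i => z i + 'i%C * 0%:C%C) = z by apply/funext => i; rewrite mulr0 addr0.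
Qed.

(** This plays the part of Hurwitz's theorem. A limit of stable polynomials may vanish identically,
    but the bound of [horner_lower_bound], which has the leading coefficient as a factor, persists
    in the limit. *)
Lemma mixed_real_rooted k l z s : admissible k -> (forall i, 0 <= Im (z i)) ->
  mixedC (upd k l (Layer 0)) z != 0 -> 0 < Im s ->
  mixedC (upd k l Full) (upd z l s) != 0.
Proof.
move=> ak zi h0 s0; set d := #|A l|.
have ak0 : admissible (upd k l (Layer 0)) by apply: admissible_upd.
have ak1 : admissible (upd k l Full) by apply: admissible_upd.
have upper v x : (forall i, 0 < Im (v i)) -> 0 < Im x ->
    sqn (mixedC (upd k l (Layer 0)) v) * Im x ^+ d.*2 <=
    sqn (mixedC (upd k l Full) (upd v l x)).
  move=> vi x0; rewrite mixed_full -group_poly_lead; apply: horner_lower_bound => //.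
  - exact: size_group_poly.
  - by rewrite group_poly_lead; apply: mixed_neq0.
  - move=> y y0; rewrite -mixed_full; apply: mixed_neq0 => // i.
    by rewrite /upd; case: eqP.
have [p1 p1E] := mixed_line (upd k l Full) (upd z l s).
have [p0 p0E] := mixed_line (upd k l (Layer 0)) z.
pose p := p1 * map_poly conj p1 - (Im s ^+ d.*2)%:C%C *: (p0 * map_poly conj p0).
have pE t : complex.Re p.[t%:C%C] = sqn p1.[t%:C%C] - sqn p0.[t%:C%C] * Im s ^+ d.*2.
  rewrite hornerD hornerN hornerZ !hornerM.
  rewrite -[X in (map_poly _ p1).[X]](conjc_real t).
  rewrite -[X in (map_poly _ p0).[X]](conjc_real t) !horner_map.
  by rewrite !conjcM_re -real_complexM -rmorphB /= mulrC.
have : 0 <= complex.Re p.[0].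
  apply: horner_re_ge0 => t t0; rewrite pE subr_ge0 p1E p0E.
  have vi i : 0 < Im (z i + 'i%C * t%:C%C).
    by rewrite !cE /= mul0r mul1r add0r ltr_wpDl.
  have st : Im s <= Im (s + 'i%C * t%:C%C).
    by rewrite !cE /= mul0r mul1r add0r lerDl ltW.
  have st0 : 0 < Im (s + 'i%C * t%:C%C) by apply: lt_le_trans st.
  have := upper _ _ vi st0.
  have -> : upd (fun i => z i + 'i%C * t%:C%C) l (s + 'i%C * t%:C%C) =
            (fun i => upd z l s i + 'i%C * t%:C%C).
    by apply/funext => i; rewrite /upd; case: eqP.
  apply: le_trans; rewrite ler_wpM2l ?addr_ge0 ?sqr_ge0 //.
  by rewrite lerXn2r // nnegrE ltW.
have zE v : (fun i => v i + 'i%C * 0%:C%C) = v :> (L -> R[i]).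
  by apply/funext => i; rewrite mulr0 addr0.
rewrite -[X in p.[X]](rmorph0 toC) pE p1E p0E !zE subr_ge0.
set u := mixedC _ _ in h0 *; set v := mixedC _ (upd z l s).
have : 0 < sqn u * Im s ^+ d.*2 by rewrite mulr_gt0 ?exprn_gt0 ?sqnorm_gt0.
move=> h1 /(lt_le_trans h1); rewrite -[v == 0]sqnorm_eq0 => h2.
by rewrite gt_eqF.
Qed.

Local Notation gR A w k z := (mixed a A k w z).

Lemma mixed_toC k (z : L -> R) : mixedC k (toC \o z) = (gR A w k z)%:C%C.
Proof. by rewrite -[RHS]/(toC _) rmorph_mixed. Qed.

Lemma pC_group_poly k (z : L -> R) l s :
  (pC (group_poly a A k w z l)).[s] = mixedC (upd k l Full) (upd (toC \o z) l s).
Proof. by rewrite mixed_full /pC map_group_poly. Qed.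

Section Compare.
Variables (k : L -> role) (l m : L) (z : L -> R) (u : R).
Hypotheses (lm : l != m) (ak : admissible k).
Hypotheses (Al : (0 < #|A l|)%N) (Am : (0 < #|A m|)%N) (u_gt0 : 0 < u).
Local Notation g rl rm t := (gR A w (upd (upd k m rm) l rl) (upd z l t)).

Hypothesis lead_gt0 : forall t, 0 < g (Layer 0) (Layer 0) t.
Hypothesis roots_bounded : forall t, u <= `|t| -> g Full (Layer 0) t != 0.

(* With z_l = t, the root of [g _ Single t] in the variable z_m is
   - w_m * g _ (Layer 1) t / g _ (Layer 0) t. *)
Lemma compare_groups :
  [/\ 0 < g Full (Layer 0) u,
      forall t, u <= `|t| ->
        - g Full (Layer 1) t / g Full (Layer 0) t <=
        - g Full (Layer 1) u / g Full (Layer 0) u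
    & forall x, 2 * u * w l * g (Layer 0) (Layer 0) x <= g Single (Layer 0) x ->
        - g Single (Layer 1) x * g Full (Layer 0) u <=
        - g Single (Layer 0) x * g Full (Layer 1) u].
Proof.
pose P := group_poly a A (upd k m (Layer 0)) w z l.
pose p := - group_poly a A (upd k m (Layer 1)) w z l.
have ml : m != l by rewrite eq_sym.
have PC s : (pC P).[s] = mixedC (upd (upd k m (Layer 0)) l Full) (upd (toC \o z) l s).
  exact: pC_group_poly.
have Pt t : g Full (Layer 0) t = P.[t] by rewrite mixed_full.
have pt t : - g Full (Layer 1) t = p.[t] by rewrite mixed_full hornerN.
have Plead t : g (Layer 0) (Layer 0) t = P`_#|A l|.
  by rewrite group_poly_lead mixed_layer.
have Ptop x : g Single (Layer 0) x = top2 x (w l) #|A l| P.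
  by rewrite mixed_single /top2 group_poly_lead group_poly_next.
have ptop x : - g Single (Layer 1) x = top2 x (w l) #|A l| p.
  rewrite mixed_single /top2 /p !coefN group_poly_lead group_poly_next //.
  by rewrite !mulrN opprD.
have P0 : 0 < P`_#|A l| by rewrite -(Plead u).
have sP : size P = #|A l|.+1.
  apply/eqP; rewrite eqn_leq size_group_poly ltnNge.
  by apply: contraL P0 => sP; rewrite nth_default ?ltxx.
have z0 i : 0 <= Im ((toC \o z) i) by [].
have zs s : 0 < Im s -> forall i, 0 <= Im (upd (toC \o z) l s i).
  by move=> s0 i; rewrite /upd; case: eqP => // _; rewrite ltW.
have [] := @nevanlinna_compare R P p #|A l| u Al sP P0.
- by rewrite size_polyN size_group_poly.
- move=> s s0; rewrite PC; apply: mixed_real_rooted => //.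
    exact: admissible_upd.
  rewrite mixed_toC -(mixed_layer _ _ _ _ _ _ _ u).
  by rewrite eq_complex /= negb_and gt_eqF ?lead_gt0.
- move=> s s0; rewrite PC /p /pC rmorphN hornerN mulNr ImN oppr_le0.
  rewrite -/(pC _) pC_group_poly ![upd (upd k m _) l Full]updC //.
  apply: mixed_nevanlinna => //; first exact: admissible_upd.
  exact: zs.
- exact: u_gt0.
- by move=> t ut; rewrite -Pt roots_bounded.
move=> h1 h2 h3; split.
- by rewrite Pt.
- by move=> t ut; rewrite !pt !Pt h2.
- by move=> x; rewrite (Plead x) Ptop ptop mulNr -mulrN pt Pt => /h3; apply.
Qed.
End Compare.

(** With g q r the polynomial with layers q of m and r of l, the difference of the two sides is w_l
    w_m (g 1 0 * g 0 1 - g 0 0 * g 1 1). This is w_m times the imaginary part in [mixed_nevanlinna]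
    for m, taken at z_l = i with the other coordinates real. *)
Lemma mixed_rayleigh k l m z : l != m -> admissible k ->
  (0 < #|A l|)%N -> (0 < #|A m|)%N ->
  gR A w (upd (upd k m Single) l (Layer 0)) z * gR A w (upd (upd k m (Layer 0)) l Single) z >=
  gR A w (upd (upd k m Single) l Single) z * gR A w (upd (upd k m (Layer 0)) l (Layer 0)) z.
Proof.
move=> lm ak Al Am; have ml : m != l by rewrite eq_sym.
pose g q r := gR A w (upd (upd k m (Layer q)) l (Layer r)) z.
have E s q : mixedC (upd (upd k m (Layer q)) l Single) (upd (toC \o z) l s) =
    s * (g q 0%N)%:C%C + (w l * g q 1%N)%:C%C.
  by rewrite mixed_single !mixed_toC real_complexM.
have S1 q : gR A w (upd (upd k m (Layer q)) l Single) z = z l * g q 0%N + w l * g q 1%N.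
  by rewrite -[in LHS](upd_id z l) mixed_single.
have S2 r : gR A w (upd (upd k m Single) l (Layer r)) z = z m * g 0%N r + w m * g 1%N r.
  by rewrite updC // -[in LHS](upd_id z m) mixed_single /g ![upd (upd k l _) m _]updC.
have S3 : gR A w (upd (upd k m Single) l Single) z =
    z l * (z m * g 0%N 0%N + w m * g 1%N 0%N) + w l * (z m * g 0%N 1%N + w m * g 1%N 1%N).
  by rewrite -[in LHS](upd_id z l) mixed_single !S2.
have : 0 <= Im (mixedC (upd (upd k l Single) m (Layer 1)) (upd (toC \o z) l 'i%C) *
    conj (mixedC (upd (upd k l Single) m (Layer 0)) (upd (toC \o z) l 'i%C))).
  apply: mixed_nevanlinna => //; first exact: admissible_upd.
  by move=> i; rewrite /upd; case: eqP.
rewrite ![upd (upd k l _) m _]updC // !E !cE /= => h.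
rewrite S1 S2 S3 -subr_ge0.
apply: (le_trans (mulr_ge0 (ltW (w_gt0 m)) h)).
by rewrite le_eqVlt; apply/orP; left; apply/eqP; rewrite /g; ring.
Qed.

Hypothesis A_gt0 : forall l, (0 < #|A l|)%N.

Lemma mixed_layer_indep k z z' :
  (forall l, z l = z' l \/ exists q, k l = Layer q) -> gR A w k z = gR A w k z'.
Proof.
move=> H; apply: eq_bigr => y _; congr (_ * _); apply: eq_bigr => l _.
by case: (H l) => [->|[q ->]].
Qed.

Definition roles (P U : {set L}) l :=
  if l \in U then Single else if l \in P then Full else Layer 0.

Lemma admissible_roles P U : admissible (roles P U).
Proof. by move=> l; split => //; rewrite /roles; case: ifP => // _; case: ifP. Qed.

Lemma roles_single (P U : {set L}) m : roles P (m |: U) = upd (roles P U) m Single.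
Proof.
by apply/funext => i; rewrite /roles /upd in_setU1; case: eqP.
Qed.

Lemma roles_remove (P U : {set L}) m : m \notin U ->
  roles (P :\ m) U = upd (roles P U) m (Layer 0).
Proof.
move=> mU; apply/funext => i; rewrite /roles /upd in_setD1.
by case: eqP => [->|]; rewrite ?(negPf mU).
Qed.

Lemma roles_full (P U : {set L}) m : m \in P -> m \notin U ->
  upd (roles P U) m Full = roles P U.
Proof.
move=> mP mU; apply/funext => i; rewrite /roles /upd.
by case: eqP => // ->; rewrite (negPf mU) mP.
Qed.

Variables (u kap x : R).
Hypotheses (u_gt0 : 0 < u) (kx : forall l, kap + 2 * u * w l <= x).

Definition point (U : {set L}) l := if l \in U then x else u.

Lemma point_full (U : {set L}) l : l \notin U -> upd (point U) l u = point U.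
Proof.
by move=> lU; apply/funext => i; rewrite /upd /point; case: eqP => // ->; rewrite (negPf lU).
Qed.

Lemma point_single (U : {set L}) m : point (m |: U) = upd (point U) m x.
Proof. by apply/funext => i; rewrite /point /upd in_setU1; case: eqP. Qed.

(** The third clause bounds by [kap] the barrier function of l, which is w_l times - [Layer 1] /
    [Layer 0]. Its denominator is the polynomial with l removed, which is why P ranges over all sets
    containing U. *)
Definition barrier (U : {set L}) := forall P : {set L}, U \subset P ->
  [/\ 0 < gR A w (roles P U) (point U),
      forall l t, l \in P :\: U -> u <= `|t| ->
        gR A w (roles P U) (upd (point U) l t) != 0
    & forall l, l \in P :\: U ->
        0 <= gR A w (upd (roles P U) l Single) (upd (point U) l kap)].

(* Once the group m is evaluated at x instead of u, the other groups see, by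
   partial fractions in z_m, a smaller logarithmic derivative. *)
Lemma barrier_step (U : {set L}) m : m \notin U -> barrier U -> barrier (m |: U).
Proof.
move=> mU B P; rewrite subUset sub1set => /andP[mP UP].
set k := roles P U; set z := point U.
have remU l (Q : {set L}) : l \notin U -> U \subset Q -> U \subset Q :\ l.
  by move=> lU UQ; rewrite subsetD1 UQ.
have mD : m \in P :\: U by rewrite in_setD mU.
have UPm := remU m P mU UP.
have kap_x : kap < x.
  have h := kx m; have h' : 0 < 2 * u * w m by rewrite !mulr_gt0.
  by lra.
have [_ _ B3] := B P UP; have [C1 C2 _] := B (P :\ m) UPm.
have akP : admissible k := @admissible_roles P U.
have S v s : gR A w (upd k m Single) (upd v m s) =
    s * gR A w (upd k m (Layer 0)) v + w m * gR A w (upd k m (Layer 1)) v.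
  exact: mixed_single.
rewrite roles_remove // -/k -/z in C1 C2.
rewrite roles_single point_single -/k -/z.
have kapS l : l \in P :\: U -> 0 <= kap * gR A w (upd k l (Layer 0)) z +
    w l * gR A w (upd k l (Layer 1)) z.
  by move=> /B3; rewrite mixed_single.
have pos v : 0 < gR A w (upd k m (Layer 0)) v ->
    0 <= kap * gR A w (upd k m (Layer 0)) v + w m * gR A w (upd k m (Layer 1)) v ->
    0 < gR A w (upd k m Single) (upd v m x).
  move=> h0 h1; rewrite S; set h := gR _ _ _ _ in h0 h1 *; set c := gR _ _ _ _ in h1 *.
  have : 0 < (x - kap) * h by rewrite mulr_gt0 // subr_gt0.
  by lra.
have facts l : l \in P :\: (m |: U) ->
    [/\ l != m, l \notin U, l \in P & l \in P :\: U].
  by rewrite !in_setD in_setU1 negb_or => /andP[/andP[-> ->] ->].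
have lead l t : l != m -> l \notin U ->
    0 < gR A w (upd (upd k m (Layer 0)) l (Layer 0)) (upd z l t).
  move=> lm lU; have [D1 _ _] := B (P :\ m :\ l) (remU _ _ lU UPm).
  by rewrite mixed_layer -!roles_remove.
split; first by apply: pos => //; apply: kapS.
- move=> l t /facts[lm lU lP lD] ut; have ml : m != l by rewrite eq_sym.
  rewrite [upd (upd z _ _) _ _]updC //.
  have kF q : upd (upd k m (Layer q)) l Full = upd k m (Layer q).
    by rewrite updC // roles_full.
  have zu : upd z l u = z by rewrite point_full.
  have nz v : u <= `|v| -> gR A w (upd k m (Layer 0)) (upd z l v) != 0.
    by move=> uv; apply: C2 => //; rewrite in_setD in_setD1 lU lm.
  (* Here z_l = t is the variable and m becomes [Single]: its root, w_m times the quotient compared,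
     is largest at t = u, where it is at most kap < x. *)
  have [|v uv|_ K _] := @compare_groups k l m z u lm akP (A_gt0 l) (A_gt0 m) u_gt0.
  + by move=> v; apply: lead.
  + by rewrite kF; apply: nz.
  have {K} := K t ut; rewrite !kF zu S.
  have := kapS m mD; have := nz t ut.
  set h := gR _ _ _ (upd z l t); set c := gR _ _ _ (upd z l t).
  set h1 := gR _ _ _ z in C1 *; set c1 := gR _ _ _ z => h0 h2 h3.
  rewrite (_ : x * h + w m * c = h * (x - w m * (- c / h))); last by field.
  rewrite mulf_neq0 // gt_eqF // subr_gt0.
  apply: (le_lt_trans _ kap_x); apply: (le_trans (ler_wpM2l (ltW (w_gt0 m)) h3)).
  by rewrite mulrA ler_pdivrMr //; lra.
- move=> l /facts[lm lU lP lD]; have ml : m != l by rewrite eq_sym.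
  have [D1 D2 D3] := B (P :\ l) (remU _ _ lU UP).
  have mDl : m \in (P :\ l) :\: U by rewrite in_setD in_setD1 mU ml.
  rewrite roles_remove // -/k -/z in D1 D2 D3.
  have kF q : upd (upd k l (Layer q)) m Full = upd k l (Layer q).
    by rewrite updC // roles_full.
  have zu : upd z m u = z by rewrite point_full.
  (* Now the variable is z_m, which passes from u to x as m becomes [Single], and the quotient
     compared is the one in the barrier function of l. *)
  have [t|t ut|h0 _ K] := @compare_groups k m l z u ml akP (A_gt0 m) (A_gt0 l) u_gt0.
  + have := lead l (z l) lm lU.
    by rewrite upd_id updC // mixed_layer.
  + by rewrite kF; apply: D2.
  have hS q : gR A w (upd (upd k m Single) l (Layer q)) (upd z m x) =
      gR A w (upd (upd k l (Layer q)) m Single) (upd z m x) by rewrite updC.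
  have leadm : 0 < gR A w (upd (upd k l (Layer 0)) m (Layer 0)) z.
    by have := lead l (z l) lm lU; rewrite upd_id updC.
  (* The margin 2 u w_m between kap and x is spent here. *)
  have H0 : 2 * u * w m * gR A w (upd (upd k l (Layer 0)) m (Layer 0)) (upd z m x) <=
      gR A w (upd (upd k l (Layer 0)) m Single) (upd z m x).
    have := D3 m mDl; rewrite !mixed_single mixed_layer.
    move: leadm; set g0 := gR _ _ _ _; set g1 := gR _ _ _ _ => g00 g10.
    have : 0 <= (x - kap - 2 * u * w m) * g0.
      by rewrite mulr_ge0 ?(ltW g00) //; have := kx m; lra.
    by lra.
  rewrite mixed_single !hS; have {K} := K x H0; rewrite !kF zu.
  have := kapS l lD.
  have H0' : 0 < gR A w (upd (upd k l (Layer 0)) m Single) (upd z m x).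
    by apply: lt_le_trans H0; rewrite mixed_layer !mulr_gt0.
  move: h0 H0'; rewrite kF zu; set h := gR _ _ _ z; set c := gR _ _ _ z.
  set H := gR _ _ _ (upd z m x); set C := gR _ _ _ (upd z m x) => h0 H0' h1 h2.
  rewrite -(pmulr_lge0 _ h0).
  have e1 := mulr_ge0 (ltW H0') h1; have e2 := ler_wpM2l (ltW (w_gt0 l)) h2.
  by lra.
Qed.

Lemma barrier_all : barrier set0 -> forall U, barrier U.
Proof.
move=> B0 U; have [n] := ubnP #|U|; elim: n => // n IH in U *; rewrite ltnS => Un.
have [->//|[m mU]] := set_0Vmem U.
rewrite -(setD1K mU); apply: barrier_step; first by rewrite setD11.
by apply: IH; apply: leq_trans Un; rewrite [in ltnRHS](cardsD1 m) mU.
Qed.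

Definition singles (P : {set L}) l := if l \in P then Single else Layer 0.

Lemma mixed_singles_gt0 (P : {set L}) : barrier set0 -> 0 < gR A w (singles P) (fun=> x).
Proof.
move=> /barrier_all B; have [+ _ _] := B P P (subxx _).
rewrite (_ : roles P P = singles P); last first.
  by apply/funext => l; rewrite /roles /singles; case: (l \in P).
rewrite (@mixed_layer_indep _ _ (fun=> x)) // => l; rewrite /point /singles.
by case: ifP => _; [left|right; exists 0%N].
Qed.
End Stability.

(** [Layer 1] sees only the one-element subsets of A m, so it is additive over a partition of A m,
    be it into singletons or into the fibres of a map. *)
Lemma mixed_sum (L F : finType) (K : comNzRingType) (I : finType) (a : {ffun L -> {set F}} -> K)
    (A : L -> {set F}) (Ai : I -> {set F}) k w z m :
  (forall S : {set F}, #|S| = 1%N ->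
     (S \subset A m)%:R = \sum_i ((S \subset Ai i)%:R : K)) ->
  mixed a A (upd k m (Layer 1)) w z =
    \sum_i mixed a (upd A m (Ai i)) (upd k m (Layer 1)) w z.
Proof.
move=> H; rewrite /mixed exchange_big /=; apply: eq_bigr => y _.
rewrite -mulr_sumr (bigD1 m) //= updE; congr (_ * _).
under [RHS]eq_bigr => i _.
  rewrite (bigD1 m) //= !updE.
  under eq_bigr => l lm do rewrite !updN //.
  over.
rewrite -mulr_suml; congr (_ * _); last by apply: eq_bigr => l lm; rewrite updN.
rewrite /weight; have [y1|y1] := eqVneq #|y m| 1%N.
  by rewrite andbT (H _ y1); apply: eq_bigr => i _; rewrite andbT.
by rewrite andbF big1 // => i _; rewrite andbF.
Qed.

Lemma mixed_layer_set (L F : finType) (K : comNzRingType) (a : {ffun L -> {set F}} -> K)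
    (A A' : L -> {set F}) k w w' z :
  (forall l, k l = Layer 0 \/ A l = A' l /\ (w l = w' l \/ k l = Layer 1)) ->
  mixed a A k w z = mixed a A' k w' z.
Proof.
move=> H; apply: eq_bigr => y _; congr (_ * _); apply: eq_bigr => l _.
have [->|[-> [->|->]] //] := H l; rewrite /= !cards_eq0.
by have [->|_] := eqVneq (y l) set0; rewrite ?sub0set ?andbF.
Qed.

Lemma singles_upd (L : finType) (P : {set L}) m : m \in P ->
  singles P = upd (singles P) m Single.
Proof.
by move=> mP; apply/funext => l; rewrite /singles /upd; case: eqP => [->|//]; rewrite mP.
Qed.

Lemma singles_remove (L : finType) (P : {set L}) m :
  singles (P :\ m) = upd (singles P) m (Layer 0).
Proof. by apply/funext => l; rewrite /singles /upd in_setD1; case: eqP. Qed.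

(** * Choosing an element of each group by the Rayleigh inequalities *)

Section Selection.
Variables (R : rcfType) (L F : finType) (a : {ffun L -> {set F}} -> R) (x : R).
Local Notation Im := (@complex.Im R).
Hypothesis full_neq0 : forall (A : L -> {set F}) k w (z : L -> R[i]),
  (forall l, k l = Full \/ k l = Layer 0) -> (forall l, 0 < Im (z l)) ->
  mixed (real_complex R \o a) A k w z != 0.

Local Notation g A w k := (mixed a A k w (fun=> x)).

(** All P are included because the Rayleigh inequalities compare a polynomial with those having
    groups removed. *)
Definition positive (A : L -> {set F}) (w : L -> R) := forall P : {set L}, 0 < g A w (singles P).

Lemma admissible_singles (A : L -> {set F}) (P : {set L}) :
  (forall l, (0 < #|A l|)%N) -> admissible A (singles P).
Proof. by move=> A0 l; rewrite /singles; case: ifP. Qed.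

(** Downward induction on P. For m in P and l outside, the Rayleigh inequality reads g(P) g(P + l -
    m) >= g(P + l) g(P - m). The right-hand side is positive, and so is g(P + l - m). *)
Lemma positive_from_full (A : L -> {set F}) (w : L -> R) m :
  (forall l, (0 < #|A l|)%N) -> (forall l, 0 < w l) ->
  (forall P : {set L}, m \notin P -> 0 < g A w (singles P)) ->
  0 < g A w (singles setT) -> positive A w.
Proof.
move=> A0 w0 H0 HT P; have [n] := ubnP #|~: P|; elim: n => // n IH in P *.
rewrite ltnS => Pn; have [mP|/H0 //] := boolP (m \in P).
have [->//|PT] := eqVneq P setT.
have [l] : exists l, l \in ~: P.
  by apply/set0Pn; apply: contra_neq PT => P0; rewrite -[P]setCK P0 setC0.
rewrite inE => lP; have lm : l != m by apply: contraNneq lP => ->.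
have SE : singles (l |: P) = upd (upd (singles P) m Single) l Single.
  apply/funext => i; rewrite /upd /singles !inE; case: (eqVneq i l) => //= _.
  by case: eqP => // ->; rewrite mP.
have ak := @admissible_singles A P A0.
have := @mixed_rayleigh R L F a full_neq0 A w w0 (singles P) l m (fun=> x) lm ak (A0 l) (A0 m).
rewrite -SE -(singles_upd mP) -(singles_remove P l).
have -> : P :\ l = P.
  by apply/setP => i; rewrite !inE; case: eqP => // ->; rewrite (negPf lP).
have -> : upd (upd (singles P) m (Layer 0)) l Single = singles ((l |: P) :\ m).
  apply/funext => i; rewrite /upd /singles !inE.
  by case: (eqVneq i l) => [->|il]; rewrite ?lm //=; case: eqP.
have -> : upd (upd (singles P) m (Layer 0)) l (Layer 0) = singles ((l |: P) :\ m :\ l).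
  apply/funext => i; rewrite /upd /singles !inE.
  by case: (eqVneq i l) => [->|il] //=; case: eqP.
have h1 : 0 < g A w (singles (l |: P)).
  apply: IH; apply: leq_trans Pn; apply: proper_card; rewrite properE setCS subsetUr /=.
  by apply/subsetPn; exists l; rewrite ?inE ?lP // negb_or eqxx.
have h2 : 0 < g A w (singles ((l |: P) :\ m)) by apply: H0; rewrite setD11.
have h3 : 0 < g A w (singles ((l |: P) :\ m :\ l)).
  by apply: H0; rewrite in_setD1 setD11 andbF.
by move=> /(lt_le_trans (mulr_gt0 h1 h3)); rewrite pmulr_lgt0.
Qed.

Lemma positive_removed (A A' : L -> {set F}) (w w' : L -> R) m (P : {set L}) :
  positive A w -> (forall l, l != m -> A l = A' l /\ w l = w' l) -> m \notin P ->
  0 < g A' w' (singles P).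
Proof.
move=> pA H mP; rewrite -(@mixed_layer_set _ _ _ _ A _ _ w) // => l.
by have [->|/H[]] := eqVneq l m; [left; rewrite /singles (negPf mP)|right; split=> //; left].
Qed.

(** With all groups present, the polynomial is the average over q of those where m is cut down to a
    fibre of p, so it is positive for some q. The same q serves every P: those without m do not see
    the change, and [positive_from_full] gives the others. *)
Lemma select_group (Q : finType) (A : L -> {set F}) (w : L -> R) m (p : F -> Q) :
  (forall l, (0 < #|A l|)%N) -> (forall q, exists e, p e = q) -> A m = setT ->
  (forall l, 0 < w l) -> w m * #|Q|%:R = 1 ->
  positive A w -> exists q, positive (upd A m [set e | p e == q]) (upd w m 1).
Proof.
move=> A0 pQ AT w0 wQ pA.
pose Aq q := upd A m [set e | p e == q]; pose w1 := upd w m 1.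
have [q /= gq] : exists q, 0 < g (Aq q) w1 (singles setT).
  apply/existsP; rewrite -[X in is_true X]negbK negb_exists; apply/negP => /forallP gn.
  have : 0 < g A w (singles setT) by [].
  suff -> : g A w (singles setT) = w m * \sum_q g (Aq q) w1 (singles setT).
    rewrite pmulr_rgt0 // ltNge => /negP; apply.
    by apply: sumr_le0 => q _; rewrite leNgt gn.
  have E B v : g B v (singles setT) =
     x * g B v (upd (singles setT) m (Layer 0)) + v m * g B v (upd (singles setT) m (Layer 1)).
    by rewrite -mixed_single -singles_upd ?inE // (upd_id (fun=> x) m).
  under eq_bigr => q _ do rewrite E /w1 updE mul1r.
  have pS (S : {set F}) : #|S| = 1%N ->
      (S \subset A m)%:R = \sum_q ((S \subset [set e | p e == q])%:R : R).
    move=> /eqP/cards1P[e ->]; rewrite AT finset.subsetT (bigD1 (p e)) //=.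
    rewrite sub1set inE eqxx big1 ?addr0 // => q qe.
    by rewrite sub1set inE eq_sym (negPf qe).
  rewrite big_split /= E (@mixed_sum _ _ _ _ _ _ _ _ _ _ _ pS) mulrDr.
  congr (_ + w m * _); last first.
    apply: eq_bigr => q _; apply: mixed_layer_set => l.
    by rewrite /w1 /Aq /upd; case: eqP => _; right; split=> //; [right|left].
  have -> : \sum_q x * g (Aq q) (upd w m 1) (upd (singles setT) m (Layer 0)) =
      \sum_(q : Q) x * g A w (upd (singles setT) m (Layer 0)).
    apply: eq_bigr => q _; congr (_ * _); apply: mixed_layer_set => l.
    by rewrite /Aq /upd; case: eqP => _; [left|right; split=> //; left].
  by rewrite sumr_const -[_ *+ _]mulr_natl mulrA wQ mul1r.
exists q; apply: (@positive_from_full _ _ m) => //.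
- move=> l; rewrite /upd; case: eqP => // _; have [e pe] := pQ q.
  by apply/card_gt0P; exists e; rewrite inE pe.
- by move=> l; rewrite /upd; case: eqP.
- move=> P mP; apply: (positive_removed pA _ mP) => l lm.
  by rewrite !updN.
Qed.

(** By the Rayleigh inequality, the quotient of [Layer 1] by [Layer 0] of m does not increase when a
    group joins P. Without other groups only the coefficient assumed to vanish remains. *)
Lemma layer1_le0 (A : L -> {set F}) (w : L -> R) m (e : F) (P : {set L}) :
  (forall l, (0 < #|A l|)%N) -> (forall l, 0 < w l) -> A m = [set e] ->
  a [ffun l => if l == m then [set e] else set0] = 0 ->
  (forall P : {set L}, m \notin P -> 0 < g A w (singles P)) ->
  g A w (upd (singles P) m (Layer 1)) <= 0.
Proof.
move=> A0 w0 Am ae H0; have [n] := ubnP #|P :\ m|; elim: n => // n IH in P *.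
rewrite ltnS => Pn; have [Pm|[l]] := set_0Vmem (P :\ m).
  rewrite /mixed (bigD1 [ffun l => if l == m then [set e] else set0]) //=.
  rewrite ae mul0r add0r big1 // => y /eqP ym.
  have [l lm|] := pickP (fun l => weight (A l) (upd (singles P) m (Layer 1) l) (w l) x (y l) == 0).
    by rewrite (bigD1 l) //= (eqP lm) mul0r mulr0.
  move=> nz; exfalso; apply: ym; apply/ffunP => l; rewrite ffunE; have := nz l.
  have [->|lm] := eqVneq l m.
    rewrite updE /= Am; case: (boolP (_ && _)) => [/andP[s1 /eqP c1] _|]; last by rewrite eqxx.
    by apply/eqP; rewrite eqEcard s1 c1 cards1.
  rewrite updN // /singles.
  have -> : (l \in P) = false.
    by apply/negbTE; move/setP/(_ l): Pm; rewrite !inE lm => /= ->.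
  rewrite /= cards_eq0; have [->//|_] := eqVneq (y l) set0.
  by rewrite andbF eqxx.
rewrite in_setD1 => /andP[lm lP].
pose k := singles P; pose q rm rl := g A w (upd (upd k m rm) l rl).
have ak := @admissible_singles A P A0.
have kl : k = upd k l Single by rewrite /k -singles_upd.
have mixm rm : upd k m rm = upd (upd k m rm) l Single.
  by rewrite [RHS]updC 1?eq_sym // -kl.
have q0S : 0 < q (Layer 0) Single.
  by rewrite /q -mixm -singles_remove H0 // setD11.
have q00 : 0 < q (Layer 0) (Layer 0).
  by rewrite /q -!singles_remove H0 // !inE eqxx andbF.
have q10 : q (Layer 1) (Layer 0) <= 0.
  rewrite /q updC 1?eq_sym // -singles_remove; apply: IH.
  apply: leq_trans Pn; apply: proper_card; apply/properP; split.
    by apply/fintype.subsetP => i; rewrite !inE => /and3P[-> _ ->].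
  by exists l; rewrite !inE ?lm // eqxx andbF.
have S rl : q Single rl = x * q (Layer 0) rl + w m * q (Layer 1) rl.
  rewrite /q -{1}(upd_id (fun=> x) m) [upd (upd k m _) l rl]updC 1?eq_sym // mixed_single.
  by rewrite ![upd (upd k l rl) m _]updC.
have := @mixed_rayleigh R L F a full_neq0 A w w0 k l m (fun=> x) lm ak (A0 l) (A0 m).
rewrite -!/(q _ _) !S mixm -/(q _ _) => h.
have : w m * q (Layer 1) Single * q (Layer 0) (Layer 0) <=
    w m * q (Layer 1) (Layer 0) * q (Layer 0) Single by lra.
rewrite -!mulrA ler_pM2l // => h1; rewrite -(pmulr_lle0 _ q00).
by apply: (le_trans h1); rewrite pmulr_lle0.
Qed.

(* Keeping only one element e of the set A m discards nonpositive terms. *)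
Lemma shrink_group (A : L -> {set F}) (w : L -> R) m (e : F) :
  (forall l, (0 < #|A l|)%N) -> (forall l, 0 < w l) -> e \in A m ->
  (forall e, a [ffun l => if l == m then [set e] else set0] = 0) ->
  positive A w -> positive (upd A m [set e]) w.
Proof.
move=> A0 w0 eA a0 pA P; have [mP|mP] := boolP (m \in P); last first.
  by apply: (positive_removed pA _ mP) => l lm; rewrite updN.
pose Ae e := upd A m [set e].
have E B : g B w (singles P) =
   x * g B w (upd (singles P) m (Layer 0)) + w m * g B w (upd (singles P) m (Layer 1)).
  by rewrite -mixed_single -singles_upd // (upd_id (fun=> x) m).
have Ae0 e' l : (0 < #|Ae e' l|)%N by rewrite /Ae /upd; case: eqP => //; rewrite cards1.
have neg e' : g (Ae e') w (upd (singles P) m (Layer 1)) <= 0.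
  apply: (@layer1_le0 _ _ _ e') => //; first by rewrite /Ae updE.
  by move=> P' mP'; apply: (positive_removed pA _ mP') => l lm; rewrite /Ae updN.
apply: (lt_le_trans (pA P)); rewrite !E.
have -> : g A w (upd (singles P) m (Layer 0)) = g (Ae e) w (upd (singles P) m (Layer 0)).
  by apply: mixed_layer_set => l; rewrite /Ae /upd; case: eqP => _; [left|right; split=> //; left].
rewrite lerD2l ler_pM2l //.
rewrite (@mixed_sum _ _ _ {e' | e' \in A m} _ _ (fun e' => [set val e'])) => [|S].
  rewrite (bigD1 (Sub e eA)) //= gerDl; apply: sumr_le0 => e' _; exact: neg.
move=> /eqP/cards1P[f ->]; rewrite sub1set; have [fA|fA] := boolP (f \in A m).
  rewrite (bigD1 (Sub f fA)) //= sub1set inE eqxx big1 ?addr0 // => e' ef.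
  rewrite sub1set inE; suff -> : (f == val e') = false by [].
  by apply: contra_neqF ef => /eqP fe; apply: val_inj.
rewrite big1 // => e' _; rewrite sub1set inE.
suff -> : (f == val e') = false by [].
by apply: contraNF fA => /eqP ->; apply: valP.
Qed.
End Selection.

(** * Principal minors of a Hermitian matrix *)

Section FinDet.
Variables (E : finType) (K : fieldType).
Implicit Types m : E -> E -> K.

Definition fdet m := \det (\matrix_(i < #|E|, j < #|E|) m (enum_val i) (enum_val j)).

Lemma eq_fdet m1 m2 : (forall e f, m1 e f = m2 e f) -> fdet m1 = fdet m2.
Proof. by move=> H; congr (\det _); apply/matrixP => i j; rewrite !mxE. Qed.

Lemma fdet_tr m : fdet (fun e f => m f e) = fdet m.
Proof. by rewrite /fdet -det_tr; congr (\det _); apply/matrixP => i j; rewrite !mxE. Qed.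

Lemma fdet_lin m m1 m2 e (b c : K) :
  (forall f, m e f = b * m1 e f + c * m2 e f) ->
  (forall e' f, e' != e -> m1 e' f = m e' f) ->
  (forall e' f, e' != e -> m2 e' f = m e' f) ->
  fdet m = b * fdet m1 + c * fdet m2.
Proof.
move=> H0 H1 H2; rewrite /fdet; apply: (determinant_multilinear (i0 := enum_rank e)).
- by apply/rowP => j; rewrite !mxE enum_rankK.
- apply/matrixP => i j; rewrite !mxE H1 //.
  apply/eqP => /(congr1 enum_rank); rewrite enum_valK => /eqP.
  by rewrite eq_sym (negPf (neq_lift _ _)).
- apply/matrixP => i j; rewrite !mxE H2 //.
  apply/eqP => /(congr1 enum_rank); rewrite enum_valK => /eqP.
  by rewrite eq_sym (negPf (neq_lift _ _)).
Qed.

Lemma fdet_row0 m e : (forall f, m e f = 0) -> fdet m = 0.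
Proof.
move=> H; rewrite (@fdet_lin m m m e 0 0) ?mul0r ?addr0 // => f.
by rewrite H !mulr0 addr0.
Qed.

Lemma fdet_id m : (forall e f, m e f = (e == f)%:R) -> fdet m = 1.
Proof.
move=> H; rewrite -(det1 K #|E|); congr (\det _); apply/matrixP => i j.
by rewrite !mxE H (inj_eq enum_val_inj).
Qed.

Lemma fdet_ker m : fdet m = 0 ->
  exists2 v : E -> K, (exists e, v e != 0) & forall e, \sum_f m e f * v f = 0.
Proof.
rewrite -fdet_tr => /eqP/det0P[v v0 vm]; exists (fun e => v 0 (enum_rank e)).
  have /rV0Pn[i vi] := v0; by exists (enum_val i); rewrite enum_valK.
move=> e; have /rowP/(_ (enum_rank e)) := vm; rewrite !mxE => vm0.
rewrite -[RHS]vm0 (reindex (@enum_val E E)) /=; last first.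
  by apply: onW_bij; apply: enum_val_bij.
by apply: eq_bigr => i _; rewrite !mxE enum_valK enum_rankK mulrC.
Qed.

Lemma fdet_ker_conv m (v : E -> K) e0 : v e0 != 0 ->
  (forall e, \sum_f m e f * v f = 0) -> fdet m = 0.
Proof.
move=> ve0 vm; rewrite -fdet_tr; apply/eqP/det0P; exists (\row_i v (enum_val i)).
  by apply/rV0Pn; exists (enum_rank e0); rewrite mxE enum_rankK.
apply/rowP => j; rewrite !mxE -[RHS](vm (enum_val j)).
rewrite [RHS](reindex (@enum_val E E)) /=; last by apply: onW_bij; apply: enum_val_bij.
by apply: eq_bigr => i _; rewrite !mxE mulrC.
Qed.

End FinDet.

Section PrincipalMinors.
Variables (E : finType) (K : fieldType) (T : E -> E -> K).

(* Outside of the rows and columns of X this is the identity, so that all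
   principal minors of diag z - T are determinants of the same size. *)
Definition pencil (X : {set E}) (z : E -> K) e f : K :=
  if (e \in X) && (f \in X) then (e == f)%:R * z e - T e f else (e == f)%:R.

Implicit Types (X Y : {set E}) (z : E -> K).

Definition pminor X z := fdet (pencil X z).

Lemma eq_pminor X z z' : {in X, z =1 z'} -> pminor X z = pminor X z'.
Proof.
move=> H; apply: eq_fdet => e f; rewrite /pencil.
by case: ifP => // /andP[/H -> _].
Qed.

Lemma pminor_set0 z : pminor set0 z = 1.
Proof. by apply: fdet_id => e f; rewrite /pencil inE. Qed.

(** The row of e is z e times a unit row plus the row for z e = 0. Next to a unit row the column of
    e may be cleared, which leaves the minor of X :\ e. *)
Lemma pminor_affine X z e : e \in X ->
  pminor X z = z e * pminor (X :\ e) z + pminor X (upd z e 0).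
Proof.
move=> eX.
pose m1 e' f := if e' == e then (e' == f)%:R else pencil X z e' f.
rewrite -[pminor X (upd _ _ _)]mul1r.
rewrite /pminor (@fdet_lin _ _ _ m1 (pencil X (upd z e 0)) e (z e) 1); first last.
- by move=> e' f ee; rewrite /pencil updN.
- by move=> e' f /negPf ee; rewrite /m1 ee.
- move=> f; rewrite /pencil /m1 eqxx eX updE /=; case: ifP => fX.
    by move: ((e == f)%:R : K) => d; ring.
  have /negPf -> : e != f by apply: contraFneq fX => <-.
  by rewrite /= mulr0 mul1r add0r.
congr (_ * _ + _); rewrite -fdet_tr.
pose m2 f e' := if f == e then (f != e')%:R * m1 e' f else m1 e' f.
rewrite (@fdet_lin _ _ _ (fun f e' => pencil (X :\ e) z e' f) m2 e 1 1); first last.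
- by move=> e' f /negPf ee; rewrite /m2 ee.
- move=> e' f ee; rewrite /m1 /pencil !in_setD1 ee.
  by have [->|fe] := eqVneq f e; rewrite // eq_sym (negPf ee).
- move=> f; rewrite /m2 /m1 /pencil !in_setD1 eqxx andbF mul1r.
  rewrite [e == f]eq_sym; have [fe|fe] := eqVneq f e; first by rewrite /= mul0r mulr0 addr0.
  by rewrite /= !mul1r add0r.
rewrite fdet_tr -[fdet m2]fdet_tr [X in _ + _ * X](@fdet_row0 _ _ _ e) => [|f].
  by rewrite mulr0 mul1r addr0.
by rewrite /m2 /m1 eqxx [e == f]eq_sym; case: eqVneq => [fe|fe]; rewrite /= ?mul0r.
Qed.

(** The nonzero variables are set to 0 one at a time by [pminor_affine]. The coefficients are the
    principal minors of - T. *)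
Lemma pminor_expand X z : pminor X z =
  \sum_(Y : {set E} | Y \subset X) (\prod_(e in X :\: Y) z e) * pminor Y (fun=> 0).
Proof.
have [n] := ubnP #|[set e in X | z e != 0]|; elim: n => // n IH in X z *.
rewrite ltnS => Xn; have [X0|[e]] := set_0Vmem [set e in X | z e != 0].
  have z0 e : e \in X -> z e = 0.
    by move=> eX; apply/eqP; move/setP/(_ e): X0; rewrite !inE eX /= => /negbFE.
  rewrite (bigD1 X) //= setDv big_set0 mul1r big1 ?addr0; first exact: eq_pminor.
  move=> Y /andP[YX YnX]; have /subsetPn[e eX eY] : ~~ (X \subset Y).
    by apply: contra YnX => XY; rewrite finset.eqEsubset YX.
  by rewrite (bigD1 e) ?inE ?eY //= z0 // !mul0r.
rewrite inE => /andP[eX ze]; rewrite (pminor_affine _ eX) !IH; last first.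
- apply: leq_trans Xn; apply: proper_card; apply/properP; split.
    by apply/fintype.subsetP => f; rewrite !inE => /andP[/andP[_ ->] ->].
  by exists e; rewrite !inE ?eX // eqxx.
- apply: leq_trans Xn; apply: proper_card; apply/properP; split.
    apply/fintype.subsetP => f; rewrite !inE /upd.
    by case: (f == e) => /andP[-> h] //; rewrite eqxx in h.
  by exists e; rewrite !inE ?eX // updE eqxx.
rewrite [RHS](bigID (fun Y : {set E} => e \in Y)) /= [RHS]addrC; congr (_ + _).
  rewrite mulr_sumr; apply: eq_big => [Y|Y].
    by rewrite subsetD1.
  rewrite subsetD1 => /andP[YX eY]; rewrite mulrA; congr (_ * _).
  rewrite [in RHS](bigD1 e) ?inE ?eY //=; congr (_ * _); apply: eq_bigl => f.
  by rewrite !inE; case: (f == e); rewrite ?andbF ?andbT.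
rewrite (bigID (fun Y : {set E} => e \in Y)) /= [X in _ + X]big1 ?addr0.
  apply: eq_bigr => Y /andP[YX eY]; congr (_ * _); apply: eq_bigr => f.
  by rewrite !inE => /andP[fY _]; rewrite updN //; apply: contraNneq fY => ->.
by move=> Y /andP[YX eY]; rewrite (bigD1 e) ?inE ?eY //= updE !mul0r.
Qed.

Lemma pminor_ker X z : pminor X z = 0 ->
  exists v : E -> K, [/\ exists2 e, e \in X & v e != 0, forall e, e \notin X -> v e = 0
    & forall e, e \in X -> z e * v e = \sum_f T e f * v f].
Proof.
move=> /fdet_ker[v [e0 ve0] vm].
have vX e : e \notin X -> v e = 0.
  move=> eX; have := vm e; rewrite (bigD1 e) //= big1 ?addr0.
    by rewrite /pencil (negPf eX) eqxx mul1r.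
  by move=> f fe; rewrite /pencil (negPf eX) /= eq_sym (negPf fe) mul0r.
exists v; split=> //.
  by exists e0 => //; apply: contraNT ve0 => /vX ->.
move=> e eX; have := vm e; rewrite /pencil eX /=.
rewrite (eq_bigr (fun f => (e == f)%:R * z e * v f - T e f * v f)) => [|f _]; last first.
  have [fX|/vX ->] := boolP (f \in X); first by rewrite mulrBl.
  by rewrite !mulr0 subrr.
rewrite sumrB => /eqP; rewrite subr_eq0 => /eqP <-.
rewrite (bigD1 e) //= eqxx mul1r big1 ?addr0 // => f fe.
by rewrite eq_sym (negPf fe) !mul0r.
Qed.

End PrincipalMinors.

Section HermitianPencil.
Variables (R : rcfType) (E : finType) (T : E -> E -> R[i]).
Local Notation Re := (@complex.Re R).
Local Notation Im := (@complex.Im R).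
Local Notation conj := (@conjc R).
Local Notation toC := (real_complex R).

Implicit Types (X : {set E}).
Hypothesis herm : forall e f, T f e = conj (T e f).

Lemma sqn_ge0 (x : R[i]) : 0 <= sqn x.
Proof. by rewrite addr_ge0 ?sqr_ge0. Qed.

Lemma sqn_gt0 (x : R[i]) : x != 0 -> 0 < sqn x.
Proof. exact: sqnorm_gt0. Qed.

Lemma sqn0 : sqn (0 : R[i]) = 0.
Proof. by rewrite /sqn /= expr0n addr0. Qed.

Lemma sqn_real (r : R) : sqn r%:C%C = r ^+ 2.
Proof. by rewrite /sqn /= expr0n addr0. Qed.

Lemma sqn_conj (x : R[i]) : sqn (conj x) = sqn x.
Proof. by rewrite /sqn !cE; ring. Qed.

Lemma sqn_sum_gt0 (v : E -> R[i]) e : v e != 0 -> 0 < \sum_e sqn (v e).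
Proof.
move=> ve; rewrite (bigD1 e) //= ltr_pwDl ?sqn_gt0 //.
by apply: sumr_ge0 => f _; apply: sqn_ge0.
Qed.

Lemma cauchy_schwarz (v w : E -> R[i]) :
  sqn (\sum_e v e * w e) <= (\sum_e sqn (v e)) * (\sum_e sqn (w e)).
Proof.
set al := \sum_e sqn (v e); set be := \sum_e sqn (w e); set ga := \sum_e _.
have be0 : 0 <= be by apply: sumr_ge0 => e _; apply: sqn_ge0.
have [be00|beN] := eqVneq be 0.
  suff -> : ga = 0 by rewrite sqn0 be00 mulr0.
  apply: big1 => e _; suff -> : w e = 0 by rewrite mulr0.
  apply/eqP; have [//|we] := boolP (w e == 0).
  by have := sqn_sum_gt0 we; rewrite -/be be00 ltxx.
have bep : 0 < be by rewrite lt0r beN.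
have : 0 <= \sum_e sqn (be%:C%C * v e - ga * conj (w e)).
  by apply: sumr_ge0 => e _; apply: sqn_ge0.
have E2 (b : R) (g : R[i]) : \sum_e sqn (b%:C%C * v e - g * conj (w e)) =
    b ^+ 2 * al - 2 * b * Re (\sum_e (v e * w e) * conj g) + sqn g * be.
  rewrite /al /be Re_sum !mulr_sumr -sumrB -big_split /=; apply: eq_bigr => e _.
  by rewrite /sqn !cE; ring.
rewrite E2 -mulr_suml -/ga conjcM_re Re_real -/(sqn ga) => h.
rewrite -(ler_pM2l bep); move: h; lra.
Qed.

Lemma pminor_conj X (r : E -> R) : Im (pminor T X (toC \o r)) = 0.
Proof.
have : conj (pminor T X (toC \o r)) = pminor T X (toC \o r).
  rewrite /pminor -[RHS]fdet_tr /fdet -[LHS]det_map_mx; congr (\det _).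
  apply/matrixP => i j; rewrite !mxE /pencil andbC [enum_val j == _]eq_sym.
  case: ifP => _; last by rewrite -[LHS]/(conj _) rmorph_nat.
  rewrite [LHS]rmorphB [X in X - _]rmorphM rmorph_nat /= oppr0 [in RHS]herm.
  by have [->|ij] := eqVneq (enum_val i) (enum_val j); rewrite ?mul0r.
case: (pminor _ _ _) => p q [/eqP].
by rewrite -subr_eq0 -opprD oppr_eq0 -mulr2n mulrn_eq0 /= => /eqP.
Qed.

(** A kernel vector v would make the sum of the z_e |v_e|^2 equal to v* T v, which is real. *)
Lemma pminor_upper X (z : E -> R[i]) : (forall e, e \in X -> 0 < Im (z e)) ->
  pminor T X z != 0.
Proof.
move=> z0; apply/eqP => /pminor_ker[v [[e0 eX ve0] vX vT]].
pose S := \sum_e conj (v e) * \sum_f T e f * v f.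
have SE : S = \sum_(e in X) conj (v e) * (z e * v e).
  rewrite /S (bigID (mem X)) /= [X in _ + X]big1 ?addr0.
    by apply: eq_bigr => e /vT ->.
  by move=> e /vX ->; rewrite conjc0 mul0r.
have SI : Im S = 0.
  have SC : conj S = S.
    rewrite /S rmorph_sum /=; under eq_bigr => e _ do rewrite conjcM conjcK rmorph_sum mulr_sumr /=.
    rewrite exchange_big /=; apply: eq_bigr => e _; rewrite mulr_sumr; apply: eq_bigr => f _.
    by rewrite conjcM -herm; ring.
  apply/eqP; have := congr1 Im SC; rewrite Im_conj => /eqP.
  by rewrite -subr_eq0 -opprD oppr_eq0 -mulr2n mulrn_eq0.
have : 0 < Im S.
  rewrite SE Im_sum (bigD1 e0) //=.
  have tE e : Im (conj (v e) * (z e * v e)) = Im (z e) * sqn (v e).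
    by rewrite /sqn !cE; ring.
  rewrite tE ltr_pwDl ?mulr_gt0 ?sqn_gt0 ?z0 //.
  by apply: sumr_ge0 => e /andP[eX' _]; rewrite tE mulr_ge0 ?sqn_ge0 // ltW // z0.
by rewrite SI ltxx.
Qed.

Variable u : R.
Hypothesis u_gt0 : 0 < u.
Hypothesis normT : forall v : E -> R[i],
  4 * \sum_e sqn (\sum_f T e f * v f) <= u ^+ 2 * \sum_e sqn (v e).

Lemma pminor_far X (r : E -> R) : (forall e, e \in X -> u <= `|r e|) ->
  pminor T X (toC \o r) != 0.
Proof.
move=> ru; apply/eqP => /pminor_ker[v [[e0 eX ve0] vX vT]].
have := normT v; have := sqn_sum_gt0 ve0; set S := \sum_e sqn (v e) => S0.
have : u ^+ 2 * S <= \sum_e sqn (\sum_f T e f * v f).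
  rewrite /S mulr_sumr; apply: ler_sum => e _.
  have [eX'|/vX ->] := boolP (e \in X); last by rewrite sqn0 mulr0 sqn_ge0.
  rewrite -vT // sqnM ler_wpM2r ?sqn_ge0 // sqn_real -(real_normK (num_real (r e))).
  by rewrite lerXn2r ?nnegrE ?(ltW u_gt0) // ru.
have : 0 < u ^+ 2 * S by rewrite mulr_gt0 ?exprn_gt0.
move=> h1 h2 h3; lra.
Qed.

Hypothesis diagT : forall e, T e e = 0.
Variable be : E -> R.
Hypothesis rowT : forall e, \sum_f sqn (T e f) <= be e.
Hypothesis be_small : forall e, 4 * be e <= u ^+ 2.

(* Writing v for the kernel vector, both |rho v_e|^2 <= be e * |v'|^2 and
   |v'|^2 <= 4 be e / u^2 * |v_e|^2 where v' is the part of v off e. *)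
Lemma pminor_root X e (rho : R) : e \notin X ->
  pminor T (e |: X) (toC \o upd (fun=> u) e rho) = 0 -> rho <= 2 * be e / u.
Proof.
move=> eX p0; have [v [[e0 e0X ve0] vX vT]] := pminor_ker p0.
have XE f : f \in X -> f != e by move=> fX; apply: contraNneq eX => <-.
have vT' f : f \in X -> u%:C%C * v f = \sum_i T f i * v i.
  by move=> fX; rewrite -vT ?inE ?fX ?orbT //= updN // XE.
have vTe : rho%:C%C * v e = \sum_i T e i * v i.
  by rewrite -vT ?setU11 //= updE.
pose v' f := if f \in X then v f else 0.
have vv' f : v f = v' f + (f == e)%:R * v e.
  rewrite /v'; have [fX|fX] := boolP (f \in X).
    by rewrite (negPf (XE f fX)) mul0r addr0.
  have [->|fe] := eqVneq f e; first by rewrite add0r mul1r.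
  by rewrite mul0r addr0 vX // in_setU1 negb_or fe.
have Tv f : \sum_i T f i * v i = \sum_i T f i * v' i + T f e * v e.
  rewrite (eq_bigr (fun i => T f i * v' i + T f i * ((i == e)%:R * v e))).
    rewrite big_split /=; congr (_ + _); rewrite (bigD1 e) //= eqxx mul1r big1 ?addr0 //.
    by move=> i /negPf ->; rewrite mul0r mulr0.
  by move=> i _; rewrite {1}vv' mulrDr.
set N := \sum_f sqn (v' f); set c := sqn (v e).
have N0 : 0 <= N by apply: sumr_ge0 => f _; apply: sqn_ge0.
have be0 : 0 <= be e.
  by apply: (le_trans _ (rowT e)); apply: sumr_ge0 => f _; apply: sqn_ge0.
have h1 : rho ^+ 2 * c <= be e * N.
  rewrite /c -sqn_real -sqnM vTe Tv diagT mul0r addr0.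
  by apply: (le_trans (cauchy_schwarz _ _)); rewrite ler_wpM2r.
(* On X, u v' is T v' plus v_e times the column of e. As the norm of T is at most u / 2, the
   contribution of T v' is absorbed by the left-hand side. *)
have h2 : u ^+ 2 * N <= 4 * be e * c.
  have : u ^+ 2 * N <= 2 * \sum_f sqn (\sum_i T f i * v' i) + 2 * \sum_f sqn (T f e * v e).
    rewrite !mulr_sumr -big_split /=; apply: ler_sum => f _.
    have [fX|fX] := boolP (f \in X); last first.
      have -> : v' f = 0 by rewrite /v' (negPf fX).
      by rewrite sqn0 mulr0 addr_ge0 // mulr_ge0 ?sqn_ge0.
    have -> : v' f = v f by rewrite /v' fX.
    rewrite -sqn_real -sqnM vT' // Tv; move: (\sum_i _) (T f e * v e) => p q.
    rewrite -subr_ge0 (_ : _ - _ = sqn (p - q)) ?sqn_ge0 // /sqn !cE; ring.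
  have -> : \sum_f sqn (T f e * v e) = (\sum_f sqn (T e f)) * c.
    by rewrite mulr_suml; apply: eq_bigr => f _; rewrite sqnM herm sqn_conj.
  have h3 : (\sum_f sqn (T e f)) * c <= be e * c by rewrite ler_wpM2r ?sqn_ge0 ?rowT.
  have h4 := normT v'; rewrite -/N in h4.
  by move=> h5; lra.
have c0 : 0 < c.
  rewrite sqn_gt0 //; apply: contraNneq ve0 => ve.
  have : N <= 0.
    have : u ^+ 2 * N <= 0 by rewrite (le_trans h2) // /c ve sqn0 mulr0.
    by rewrite pmulr_rle0 // exprn_gt0.
  move=> NN; have v0 : forall f, v' f = 0.
    move=> f; apply/eqP; have [//|vf] := boolP (v' f == 0).
    by have := sqn_sum_gt0 vf; rewrite ltNge NN.
  by rewrite vv' v0 ve mulr0 addr0.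
rewrite ler_pdivlMr //.
have [r0|r0] := lerP rho 0.
  by apply: (@le_trans _ _ 0); [rewrite mulr_le0_ge0 // ltW|rewrite mulr_ge0].
rewrite -(@ler_pXn2r _ 2) ?nnegrE ?mulr_ge0 ?(ltW u_gt0) ?(ltW r0) //.
rewrite -(ler_pM2r c0).
have h3 := ler_wpM2l be0 h2; have h4 := ler_wpM2r (ltW (exprn_gt0 2 u_gt0)) h1.
rewrite !exprMn; lra.
Qed.

Definition rminor (X : {set E}) (r : E -> R) := Re (pminor T X (toC \o r)).

Lemma rminorE X r : pminor T X (toC \o r) = (rminor X r)%:C%C.
Proof. by apply: eqcP; rewrite //= pminor_conj. Qed.

Lemma eq_rminor X r r' : {in X, r =1 r'} -> rminor X r = rminor X r'.
Proof.
by move=> H; rewrite /rminor (@eq_pminor _ _ _ X _ (toC \o r')) // => e eX /=; rewrite H.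
Qed.

Lemma rminor_affine X r e : e \in X ->
  rminor X r = r e * rminor (X :\ e) r + rminor X (upd r e 0).
Proof.
move=> eX; rewrite /rminor (pminor_affine _ _ eX) ReD ReM /= mul0r subr0.
congr (_ + Re (pminor _ _ _)); apply/funext => f; rewrite /= /upd.
by case: eqP.
Qed.

(** The minor of e |: X is affine in the variable of e. Minus the quotient of the two minors is its
    root, which [pminor_root] bounds. *)
Lemma rminor_u X e : e \notin X -> 0 < rminor X (fun=> u) ->
  - rminor (e |: X) (upd (fun=> u) e 0) <= 2 * be e / u * rminor X (fun=> u).
Proof.
move=> eX X0; rewrite -ler_pdivrMr //; set rho := _ / _.
apply: (pminor_root eX); rewrite rminorE (rminor_affine _ (setU11 _ _)).
rewrite updE setU1K //; have -> : rminor X (upd (fun=> u) e rho) = rminor X (fun=> u).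
  by apply: eq_rminor => f fX; rewrite updN //; apply: contraNneq eX => <-.
by rewrite upd_upd /rho divfK ?gt_eqF // addrC subrr.
Qed.

(** Elements are added one at a time: the root in the variable of the new e is at most 2 be e / u <=
    u / 2, hence below u. *)
Lemma rminor_gt0 X : 0 < rminor X (fun=> u).
Proof.
have [n] := ubnP #|X|; elim: n => // n IH in X *; rewrite ltnS => Xn.
have [->|[e eX]] := set_0Vmem X; first by rewrite /rminor pminor_set0 /=.
have eX' : e \notin X :\ e by rewrite setD11.
have X0 : 0 < rminor (X :\ e) (fun=> u).
  by apply: IH; apply: leq_trans Xn; rewrite [in ltnRHS](cardsD1 e) eX.
have := rminor_u eX' X0; rewrite (setD1K eX) [rminor X (fun=> u)](rminor_affine _ eX).
move: (rminor (X :\ e) _) X0 (rminor X _) => p p0 q h.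
have key (v v' : R) : - q <= v -> v < v' -> 0 < v' + q by lra.
apply: (key _ _ h); rewrite ltr_pM2r // ltr_pdivrMr // -expr2.
by have h1 := be_small e; have h2 := exprn_gt0 2 u_gt0; lra.
Qed.
End HermitianPencil.

(** * From positive minors to a bound on the Hermitian form *)

Section PositiveForm.
Variables (R : rcfType) (E : finType) (T : E -> E -> R[i]).
Local Notation Re := (@complex.Re R).
Local Notation Im := (@complex.Im R).
Local Notation conj := (@conjc R).
Local Notation toC := (real_complex R).
Hypothesis herm : forall e f, T f e = conj (T e f).
Variables (X : {set E}) (x : R).
Hypothesis x_gt0 : 0 < x.
Hypothesis minors_gt0 : forall Y : {set E}, Y \subset X -> 0 < rminor T Y (fun=> x).

(** Coordinates are raised from x one at a time. The minor is affine in each of them, and its slope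
    is a smaller minor, positive by induction. *)
Lemma rminor_mono_gt0 (Y : {set E}) (r : E -> R) : Y \subset X ->
  (forall e, e \in Y -> x <= r e) -> 0 < rminor T Y r.
Proof.
have [n] := ubnP #|[set e in Y | r e != x]|.
elim: n => // n IH in Y r *; rewrite ltnS => Yn YX rx.
have [Y0|[e]] := set_0Vmem [set e in Y | r e != x].
  rewrite (@eq_rminor _ _ _ _ _ (fun=> x)) ?minors_gt0 // => e eY.
  by apply/eqP; move/setP/(_ e): Y0; rewrite !inE eY /= => /negbFE.
rewrite inE => /andP[eY re].
have lt (Z : {set E}) (r' : E -> R) : Z \subset Y -> {in Z, forall f, f != e -> r' f = r f} ->
    (e \notin Z \/ r' e = x) -> (#|[set e in Z | r' e != x]| < n)%N.
  move=> ZY rr He; apply: leq_trans Yn; apply: proper_card; apply/properP; split.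
    apply/fintype.subsetP => f; rewrite !inE => /andP[fZ rf].
    rewrite (fintype.subsetP ZY) //=; have [fe|fe] := eqVneq f e; first by rewrite fe.
    by rewrite -rr.
  by exists e; rewrite inE ?eY //; case: He => [/negPf ->//|->]; rewrite eqxx andbF.
have h1 : 0 < rminor T (Y :\ e) r.
  apply: IH; rewrite ?(subset_trans (subsetDl _ _)) //.
  - by apply: lt; rewrite ?subsetDl //; left; rewrite setD11.
  - by move=> f; rewrite in_setD1 => /andP[_ /rx].
have h2 : 0 < rminor T Y (upd r e x).
  apply: IH => //; last by move=> f fY; rewrite /upd; case: eqP => // _; apply: rx.
  by apply: lt => //; [move=> f _ fe; rewrite updN|right; rewrite updE].
move: h2; rewrite (rminor_affine _ _ eY) [rminor _ _ r](rminor_affine _ _ eY) updE upd_upd.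
rewrite (@eq_rminor _ _ _ (Y :\ e) (upd r e x) r) => [|f]; last first.
  by rewrite in_setD1 => /andP[fe _]; rewrite updN.
have xr := rx e eY; move=> h.
by apply: (lt_le_trans h); rewrite lerD2r; apply: ler_wpM2r => //; apply: ltW h1.
Qed.

(** Padding by zeros keeps the size of the matrix and only adds the eigenvalue 0, which is below
    x. *)
Definition restricted e f := if (e \in X) && (f \in X) then T e f else 0.

Lemma eigenvalue_le (lam : R) (v : E -> R[i]) e0 : v e0 != 0 ->
  (forall e, \sum_f restricted e f * v f = lam%:C%C * v e) -> lam <= x.
Proof.
move=> ve0 Hv; rewrite leNgt; apply/negP => xl.
have l0 : 0 < lam by apply: lt_trans xl.
have vX e : e \notin X -> v e = 0.
  move=> eX; have := Hv e; rewrite big1 => [|f _]; last by rewrite /restricted (negPf eX) mul0r.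
  by move/esym/eqP; rewrite mulf_eq0 eq_complex /= (gt_eqF l0) => /eqP.
have : 0 < rminor T X (fun=> lam) by apply: rminor_mono_gt0 => // e _; apply: ltW.
suff : pminor T X (toC \o (fun=> lam)) = 0.
  by rewrite /rminor => ->; rewrite ltxx.
have e0X : e0 \in X by apply: contraNT ve0 => /vX ->.
apply: (fdet_ker_conv ve0) => e.
have [eX|eX] := boolP (e \in X); last first.
  apply: big1 => f _; rewrite /pencil (negPf eX) /=.
  by have [<-|ef] := eqVneq e f; rewrite ?mul0r // vX ?mulr0.
rewrite (eq_bigr (fun f => (e == f)%:R * (lam%:C%C * v f) - restricted e f * v f)) => [|f _].
  rewrite sumrB Hv (bigD1 e) //= eqxx mul1r big1 ?addr0 ?subrr // => f fe.
  by rewrite eq_sym (negPf fe) mul0r.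
rewrite /pencil /restricted eX /=; case: ifPn => [fX|/vX ->]; first by rewrite mulrBl mulrA.
by rewrite !mulr0 subr0.
Qed.

Local Open Scope sesquilinear_scope.

(** By the spectral theorem for [restricted], the form is a sum of eigenvalues times squared moduli
    of coordinates, and [eigenvalue_le] bounds the eigenvalues. *)
Lemma form_le (v : E -> R[i]) : (forall e, e \notin X -> v e = 0) ->
  Re (\sum_e \sum_f conj (v e) * T e f * v f) <= x * \sum_e sqn (v e).
Proof.
move=> vX; pose n := #|E|.
pose A : 'M[R[i]]_n := \matrix_(i, j) restricted (enum_val i) (enum_val j).
have Ah : A \is hermsymmx.
  apply/is_hermitianmxP; rewrite expr0 scale1r; apply/matrixP => i j; rewrite !mxE.
  rewrite /restricted andbC; case: ifP => _; first exact: herm.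
  by rewrite rmorph0.
have /orthomx_spectralP := hermitian_normalmx Ah.
have /mxOverP Dr := hermitian_spectral_diag_real Ah.
set P := spectralmx A; set D := spectral_diag A in Dr * => AE.
have PU : P \is unitarymx := spectral_unitarymx A.
pose w : 'rV[R[i]]_n := \row_i conj (v (enum_val i)).
have [y yE] : {y | y = w *m P^t*} by exists (w *m P^t*).
have sumE (V : nmodType) (f : E -> V) : \sum_e f e = \sum_(i < n) f (enum_val i).
  by rewrite (reindex (@enum_val E E)) //; apply: onW_bij; apply: enum_val_bij.
have quad : \sum_e \sum_f conj (v e) * T e f * v f = \sum_i D 0 i * (y 0 i * conj (y 0 i)).
  have -> : \sum_e \sum_f conj (v e) * T e f * v f = (w *m A *m w^t*) 0 0.
    rewrite mxE sumE exchange_big /= sumE; apply: eq_bigr => j _.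
    rewrite !mxE mulr_suml; apply: eq_bigr => i _; rewrite !mxE /=.
    rewrite /restricted; have [iX|/vX ->] := boolP (enum_val i \in X); last first.
      by rewrite conjc0 !mul0r.
    have [jX|/vX ->] := boolP (enum_val j \in X); last first.
      by rewrite conjc0 mulr0 -[RHS]/(_ * conj 0) conjc0 mulr0.
    by congr (_ * _); rewrite -[RHS]/(conj (conj _)) conjcK.
  rewrite AE invmx_unitary // !mulmxA -yE.
  have -> : y *m diag_mx D *m P *m w^t* = y *m diag_mx D *m y^t*.
    by rewrite yE trmx_mul map_mxM /= trmxCK mulmxA.
  rewrite mxE; apply: eq_bigr => i _; rewrite mul_mx_diag !mxE.
  by rewrite mulrAC mulrC.
have norm : \sum_i sqn (y 0 i) = \sum_e sqn (v e).
  have sqE (z : 'rV[R[i]]_n) : (z *m z^t*) 0 0 = (\sum_i sqn (z 0 i))%:C%C.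
    rewrite mxE -[RHS]/(toC _) rmorph_sum; apply: eq_bigr => i _; rewrite !mxE.
    exact: conjcM_re.
  have : (y *m y^t*) 0 0 = (w *m w^t*) 0 0.
    by rewrite yE trmx_mul map_mxM /= trmxCK !mulmxA mulmxKtV.
  rewrite !sqE => -[->]; rewrite sumE; apply: eq_bigr => i _.
  by rewrite mxE sqn_conj.
rewrite quad -norm Re_sum mulr_sumr; apply: ler_sum => i _.
have DE : D 0 i = (Re (D 0 i))%:C%C by rewrite RRe_real //; apply: Dr.
rewrite conjcM_re ReM Re_real Im_real mulr0 subr0 ler_wpM2r ?sqn_ge0 //.
have PA : P *m A = diag_mx D *m P.
  by rewrite {1}AE !mulmxA mulmxV ?mul1mx // unitarymx_unit.
have [e0 Pe0] : exists e0, conj (P i (enum_rank e0)) != 0.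
  apply/existsP; rewrite -[X in is_true X]negbK negb_exists; apply/negP => /forallP P0.
  have /matrixP/(_ i i) := unitarymxP PU; rewrite !mxE eqxx big1 => [/esym/eqP|j _].
    by rewrite oner_eq0.
  have := P0 (enum_val j); by rewrite enum_valK negbK conjc_eq0 => /eqP ->; rewrite mul0r.
apply: (eigenvalue_le (v := fun e => conj (P i (enum_rank e))) Pe0) => e.
have /matrixP/(_ i (enum_rank e)) := PA.
rewrite mul_diag_mx [RHS]mxE mxE DE => /(congr1 conj).
rewrite conjcM conjc_real => <-; rewrite rmorph_sum sumE; apply: eq_bigr => j _ /=.
rewrite conjcM enum_valK mulrC; congr (_ * _); rewrite mxE enum_rankK /restricted andbC.
by case: ifP => _; [exact: herm|rewrite conjc0].
Qed.
End PositiveForm.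

(** * Selection in a finite block matrix *)

Definition flatten_sel (L F : finType) (y : {ffun L -> {set F}}) : {set L * F} :=
  [set e | e.2 \in y e.1].

Definition is_full r := if r is Full then true else false.

(** This is [pminor_expand] with the subsets of L * F read as families of subsets of F. A [Full]
    group contributes A l, a group in [Layer 0] nothing. *)
Lemma mixed_pminor (L F : finType) (K : fieldType) (T : L * F -> L * F -> K)
    (A : L -> {set F}) k (w z : L -> K) :
  (forall l, k l = Full \/ k l = Layer 0) ->
  mixed (fun y => pminor T (flatten_sel y) (fun=> 0)) A k w z =
  pminor T [set e | is_full (k e.1) && (e.2 \in A e.1)] (fun e => z e.1).
Proof.
move=> kP; rewrite pminor_expand.
set X := [set e | _].
have fK : cancel (@flatten_sel L F) (fun Y : {set L * F} => [ffun l => [set f | (l, f) \in Y]]).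
  by move=> y; apply/ffunP => l; rewrite ffunE; apply/setP => f; rewrite !inE.
have Kf : cancel (fun Y : {set L * F} => [ffun l => [set f | (l, f) \in Y]]) (@flatten_sel L F).
  by move=> Y; apply/setP => -[l f]; rewrite inE ffunE inE.
rewrite [RHS]big_mkcond (reindex (@flatten_sel L F)) /=; last first.
  by exists (fun Y : {set L * F} => [ffun l => [set f | (l, f) \in Y]]) => ? _; rewrite ?fK ?Kf.
apply: eq_bigr => y _; case: ifPn => [yX|/subsetPn[[l f]]]; last first.
  rewrite !inE negb_and /= => fy h; rewrite (bigD1 l) //=.
  suff -> : weight (A l) (k l) (w l) (z l) (y l) = 0 by rewrite mul0r mulr0.
  case: (kP l) h => -> /=.
    by move=> fA; case: ifP => // /fintype.subsetP/(_ f fy); rewrite (negPf fA).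
  move=> _; rewrite cards_eq0; case: eqP => [y0|_]; rewrite ?andbF //.
  by rewrite y0 inE in fy.
rewrite mulrC; congr (_ * _).
rewrite (eq_bigr (fun l => \prod_(f | (l, f) \in X :\: flatten_sel y) z l)).
  rewrite pair_big_dep /=; apply: eq_bigl => -[l f] //=.
move=> l _; rewrite prodr_const.
have yl f : f \in y l -> is_full (k l) && (f \in A l).
  move=> fy; have : (l, f) \in flatten_sel y by rewrite inE.
  by move=> /(fintype.subsetP yX); rewrite inE.
have XE f : ((l, f) \in X :\: flatten_sel y) = (f \notin y l) && (is_full (k l) && (f \in A l)).
  by rewrite in_setD !inE.
case: (kP l) => kl.
  rewrite kl /=.
  have yA : y l \subset A l by apply/fintype.subsetP => f /yl /andP[].
  rewrite yA; congr (_ ^+ _); rewrite -[X in (_ - #|pred_of_set X|)%N](setIidPr yA) -cardsD.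
  by apply: eq_card => f; rewrite in_setD; apply: (etrans _ (esym (XE f))); rewrite kl.
have y0 : y l = set0.
  by apply/setP => f; rewrite inE; apply/negP => /yl; rewrite kl.
rewrite kl /= y0 sub0set cards0 eqxx eq_card0 // => f.
by apply: (etrans (XE f)); rewrite kl andbF.
Qed.

Section FiniteSelection.
Variables (R : rcfType) (L Q D : finType).
Local Notation F := (Q * D)%type.
Local Notation E := (L * (Q * D))%type.
Variable T : E -> E -> R[i].
Local Notation Im := (@complex.Im R).
Local Notation toC := (real_complex R).
Hypothesis herm : forall e f, T f e = conjc (T e f).
Hypothesis diagT : forall e, T e e = 0.
Variables (u x kap : R) (be : E -> R).
Hypothesis u_gt0 : 0 < u.
Hypothesis normT : forall v : E -> R[i],
  4 * \sum_e sqn (\sum_f T e f * v f) <= u ^+ 2 * \sum_e sqn (v e).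
Hypothesis rowT : forall e, \sum_f sqn (T e f) <= be e.
Hypothesis be_small : forall e, 4 * be e <= u ^+ 2.
Hypotheses (Q_gt0 : (0 < #|Q|)%N) (D_gt0 : (0 < #|D|)%N).
Hypothesis kapE : forall l, #|Q|%:R^-1 * \sum_f (2 * be (l, f) / u) <= kap.
Hypothesis xE : kap + 2 * u * #|Q|%:R^-1 <= x.

Definition coefs (y : {ffun L -> {set F}}) : R := rminor T (flatten_sel y) (fun=> 0).

Lemma coefsE : toC \o coefs = fun y => pminor T (flatten_sel y) (fun=> 0).
Proof.
by apply/funext => y; rewrite /= /coefs -rminorE.
Qed.

Lemma coefs_full_neq0 (A : L -> {set F}) k w (z : L -> R[i]) :
  (forall l, k l = Full \/ k l = Layer 0) -> (forall l, 0 < Im (z l)) ->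
  mixed (toC \o coefs) A k w z != 0.
Proof.
move=> kP z0; rewrite coefsE mixed_pminor //.
by apply: pminor_upper => // e _; apply: z0.
Qed.

Lemma mixed_rminor (A : L -> {set F}) k (w z : L -> R) :
  (forall l, k l = Full \/ k l = Layer 0) ->
  mixed coefs A k w z =
  rminor T [set e | is_full (k e.1) && (e.2 \in A e.1)] (fun e => z e.1).
Proof.
move=> kP; apply: (@fmorph_inj _ _ toC).
rewrite rmorph_mixed coefsE mixed_pminor //= -rminorE //.
Qed.

Let A0 : L -> {set F} := fun=> setT.
(** The average runs over the choices of q in Q and not over F: a choice keeps the pairs (q, d) for
    all blocks d. *)
Let w0 : L -> R := fun=> #|Q|%:R^-1.

Let w0_gt0 l : 0 < w0 l. Proof. by rewrite invr_gt0 ltr0n. Qed.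
Let F_gt0 : (0 < #|{: F}|)%N. Proof. by rewrite card_prod muln_gt0 Q_gt0. Qed.

Lemma roles0P (P : {set L}) l : roles P set0 l = Full \/ roles P set0 l = Layer 0.
Proof. by rewrite /roles inE; case: ifP => _; [left|right]. Qed.

(** For the third clause, [Layer 1] of l is a sum over f in F of minors in which the variable of (l,
    f) is 0. Each is bounded by [rminor_u], and their weighted sum by [kapE]. *)
Lemma barrier0 : barrier coefs A0 w0 u kap x set0.
Proof.
move=> P _; have pE : point u x (set0 : {set L}) = fun=> u.
  by apply/funext => l; rewrite /point inE.
rewrite pE; split.
- rewrite mixed_rminor; last exact: roles0P.
  by apply: (@rminor_gt0 _ _ T herm u u_gt0 normT diagT be).
- move=> l t _ ut; rewrite mixed_rminor; last exact: roles0P.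
  have : pminor T [set e | is_full (roles P set0 e.1) && (e.2 \in A0 e.1)]
      (toC \o (fun e => upd (fun=> u) l t e.1)) != 0.
    apply: (@pminor_far _ _ T u u_gt0 normT) => e _; rewrite /upd.
    by case: eqP => // _; rewrite gtr0_norm.
  rewrite rminorE //; apply: contra => /eqP ->; by rewrite rmorph0.
- move=> l; rewrite setD0 => lP; rewrite mixed_single.
  set k0 := upd (roles P set0) l (Layer 0).
  have k0P i : k0 i = Full \/ k0 i = Layer 0.
    by rewrite /k0 /upd; case: eqP => _; [right|apply: roles0P].
  rewrite [mixed _ _ k0 _ _]mixed_rminor // /A0.
  set X := [set e | _]; set h := rminor T X _.
  have h0 : 0 < h by apply: (@rminor_gt0 _ _ T herm u u_gt0 normT diagT be).
  have eX f : (l, f) \notin X by rewrite inE /= /k0 updE.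
  rewrite (@mixed_sum _ _ _ F _ _ (fun f => [set f])); last first.
    move=> S /eqP/cards1P[f ->]; rewrite finset.subsetT (bigD1 f) //=.
    rewrite subxx big1 ?addr0 // => f' ff; rewrite sub1set inE.
    by rewrite eq_sym (negPf ff).
  (* For a one-element group, [Layer 1] is the value at 0 of the role [Full]. *)
  have gE f : mixed coefs (upd A0 l [set f]) (upd (roles P set0) l (Layer 1)) w0 (fun=> u) =
      rminor T ((l, f) |: X) (upd (fun=> u) (l, f) 0).
    have -> : mixed coefs (upd A0 l [set f]) (upd (roles P set0) l (Layer 1)) w0 (fun=> u) =
       mixed coefs (upd A0 l [set f]) (upd (roles P set0) l Full) w0 (upd (fun=> u) l 0).
      apply: eq_bigr => y _; congr (_ * _); apply: eq_bigr => i _; rewrite /upd.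
      case: eqP => [->|//]; rewrite /weight cards1.
      have [S1|//] := boolP (y l \subset [set f]).
      have := S1; rewrite subset1 => /orP[/eqP->|/eqP->]; first by rewrite cards1.
      by rewrite cards0 subn0 expr1.
    rewrite mixed_rminor => [|i]; last first.
      by rewrite /upd; case: eqP => _; [left|apply: roles0P].
    have -> : [set e | is_full (upd (roles P set0) l Full e.1) && (e.2 \in upd A0 l [set f] e.1)] =
       (l, f) |: X.
      apply/setP => -[i f']; rewrite !inE /= /k0 /upd xpair_eqE.
      by case: eqP => _; rewrite /= !inE ?orbF.
    apply: eq_rminor => -[i f'] /=; rewrite !inE /upd xpair_eqE /k0 /upd /=.
    by case: eqP => //= _; rewrite ?orbF => ->.
  under eq_bigr => f _ do rewrite gE.
  have gf f : - rminor T ((l, f) |: X) (upd (fun=> u) (l, f) 0) <= 2 * be (l, f) / u * h.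
    exact: (@rminor_u _ _ T herm u u_gt0 normT diagT be).
  have : - \sum_f rminor T ((l, f) |: X) (upd (fun=> u) (l, f) 0) <=
      (\sum_f (2 * be (l, f) / u)) * h.
    by rewrite -sumrN mulr_suml; apply: ler_sum => f _.
  move: (\sum_f rminor _ _ _) h h0 {gf} => G h h0.
  move=> /(ler_wpM2l (ltW (w0_gt0 l))); rewrite mulrN mulrA => h1.
  have h2 := ler_wpM2r (ltW h0) (kapE l); rewrite -/(w0 l) in h2.
  have := le_trans h1 h2; lra.
Qed.

Lemma selection_positive (U : {set L}) : exists s : L -> Q,
  positive coefs x (fun l => if l \in U then [set e | e.1 == s l] else setT)
                   (fun l => if l \in U then 1 else #|Q|%:R^-1).
Proof.
have [q0 _] := card_gt0P Q_gt0; have [d0 _] := card_gt0P D_gt0.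
have [n] := ubnP #|U|; elim: n => // n IH in U *; rewrite ltnS => Un.
have [->|[m mU]] := set_0Vmem U.
  exists (fun=> q0) => P.
  have -> : (fun l : L => if l \in set0 then [set e : F | e.1 == q0] else setT) = A0.
    by apply/funext => l; rewrite inE.
  have -> : (fun l : L => if l \in set0 then 1 else #|Q|%:R^-1) = w0.
    by apply/funext => l; rewrite inE.
  apply: (mixed_singles_gt0 coefs_full_neq0 w0_gt0 _ u_gt0 _ _ barrier0) => //.
  by move=> l; rewrite cardsT.
have [|s ps] := IH (U :\ m).
  by apply: leq_trans Un; rewrite [in ltnRHS](cardsD1 m) mU.
set A := (fun l : L => _) in ps; set w := (fun l : L => _) in ps.
have A1 l : (0 < #|A l|)%N.
  rewrite /A; case: ifP => _; last by rewrite cardsT.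
  by apply/card_gt0P; exists (s l, d0); rewrite inE.
have w1 l : 0 < w l by rewrite /w; case: ifP => // _; rewrite invr_gt0 ltr0n.
have [||q pq] := @select_group _ _ _ _ _ coefs_full_neq0 Q A w m fst A1
  (fun q => ex_intro _ (q, d0) erefl) _ w1 _ ps.
- by rewrite /A setD11.
- by rewrite /w setD11 mulVf // pnatr_eq0 -lt0n.
exists (upd s m q); move: pq; congr (positive _ _ _ _); apply/funext => l.
  rewrite /upd /A in_setD1; case: eqP => [->|_] //=; last by rewrite mU.
by rewrite /upd /w in_setD1; case: eqP => [->|_] //=; rewrite mU.
Qed.

Lemma coefs_single m (e : F) :
  coefs [ffun l => if l == m then [set e] else set0] = 0.
Proof.
rewrite /coefs (_ : flatten_sel _ = [set (m, e)]); last first.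
  apply/setP => -[l f]; rewrite !inE /= ffunE xpair_eqE.
  by case: eqP => _; rewrite !inE.
rewrite /rminor /pminor (@fdet_row0 _ _ _ (m, e)) // => -[l f].
rewrite /pencil !inE eqxx xpair_eqE /=; case: ifP => [/andP[/eqP-> /eqP->]|].
  by rewrite mulr0 diagT subr0.
by move=> h; case: eqP => // -[mm ee]; rewrite mm ee !eqxx in h.
Qed.

Hypothesis x_gt0 : 0 < x.

(** The selector is fixed before the block d: for each d, shrinking the groups to the single pairs
    (s l, d) preserves positivity. What is left are principal minors of x - T on the selected
    elements of block d, to which [form_le] applies. *)
Lemma selection_form : exists s : L -> Q, forall (d : D) (c : L -> R[i]),
  complex.Re (\sum_l \sum_m conjc (c l) * T (l, (s l, d)) (m, (s m, d)) * c m) <=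
  x * \sum_l sqn (c l).
Proof.
have [s ps] := selection_positive setT; exists s => d c.
have pd (U : {set L}) : positive coefs x
    (fun l => if l \in U then [set (s l, d)] else [set e | e.1 == s l]) (fun=> 1).
  have [n] := ubnP #|U|; elim: n => // n IH in U *; rewrite ltnS => Un.
  have [->|[m mU]] := set_0Vmem U.
    move: ps; congr (positive _ _ _ _); apply/funext => l; rewrite !inE //.
  have /IH pm : (#|U :\ m| < n)%N.
    by apply: leq_trans Un; rewrite [in ltnRHS](cardsD1 m) mU.
  set A := (fun l : L => _) in pm.
  have A1 l : (0 < #|A l|)%N.
    rewrite /A; case: ifP => _; first by rewrite cards1.
    by apply/card_gt0P; exists (s l, d); rewrite inE.
  have := @shrink_group _ _ _ _ _ coefs_full_neq0 A (fun=> 1) m (s m, d) A1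
    (fun=> ltr01) _ (coefs_single m) pm.
  rewrite /A setD11 inE eqxx => /(_ isT); congr (positive _ _ _ _).
  by apply/funext => l; rewrite /upd in_setD1; case: eqP => [->|//]; rewrite mU.
pose X := [set e : E | e.2 == (s e.1, d)].
have minors (Y : {set E}) : Y \subset X -> 0 < rminor T Y (fun=> x).
  move=> YX; have := pd setT [set l | (l, (s l, d)) \in Y].
  have -> : (fun l => if l \in [set: L] then [set (s l, d)] else [set e : F | e.1 == s l]) =
            (fun l => [set (s l, d)]) by apply/funext => l; rewrite inE.
  set P := [set l | _].
  (* For a one-element group of weight 1 the roles [Single] and [Full] agree. *)
  have -> : mixed coefs (fun l => [set (s l, d)]) (singles P) (fun=> 1) (fun=> x) =
            mixed coefs (fun l => [set (s l, d)]) (roles P set0) (fun=> 1) (fun=> x).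
    apply: eq_bigr => y _; congr (_ * _); apply: eq_bigr => l _.
    rewrite /singles /roles in_set0; case: ifP => // _.
    rewrite /weight cards1 mulr1; have [S1|S1] := boolP (y l \subset [set (s l, d)]); last first.
      by case: eqP S1 => [->|//]; rewrite sub0set.
    have := S1; rewrite subset1 => /orP[/eqP->|/eqP->].
      by rewrite cards1 -cards_eq0 cards1.
    by rewrite eqxx cards0 subn0 expr1.
  rewrite mixed_rminor; last exact: roles0P.
  congr (0 < rminor T _ _); apply/setP => -[l f]; rewrite !inE /=.
  rewrite /roles in_set0 inE; have [->|fs] := eqVneq f (s l, d).
    by rewrite andbT; case: ifP.
  rewrite andbF; apply/esym/negbTE; apply: contra fs => /(fintype.subsetP YX).
  by rewrite inE.
pose v (e : E) := if e \in X then c e.1 else 0.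
have sumE (V : nmodType) (f : E -> V) : (forall e, e \notin X -> f e = 0) ->
    \sum_e f e = \sum_l f (l, (s l, d)).
  move=> f0; rewrite (eq_bigr (fun p => f (p.1, p.2))) => [|[]//].
  rewrite -(pair_bigA _ (fun l q => f (l, q))) /=; apply: eq_bigr => l _.
  by rewrite (bigD1 (s l, d)) //= big1 ?addr0 // => q qs; apply: f0; rewrite inE.
have vX e : e \notin X -> v e = 0 by rewrite /v => /negPf ->.
have vE l : v (l, (s l, d)) = c l by rewrite /v inE eqxx.
have := form_le herm x_gt0 minors vX.
rewrite [in leRHS]sumE => [|e /vX ->]; last by rewrite sqn0.
rewrite [in leLHS]sumE => [|e /vX ->]; last first.
  by rewrite conjc0 big1 // => f _; rewrite !mul0r.
rewrite (eq_bigr (fun l => sqn (c l))) => [|l _]; last by rewrite vE.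
congr (complex.Re _ <= _); apply: eq_bigr => l _.
rewrite sumE => [|e /vX ->]; last by rewrite mulr0.
by apply: eq_bigr => m _; rewrite !vE.
Qed.
End FiniteSelection.

From mathcomp Require Import all_classical all_reals all_analysis.
Import numFieldNormedType.Exports.

Local Open Scope classical_set_scope.
Local Open Scope ring_scope.

(** * Gram matrices and infinite index sets *)

Section ScalarEmbedding.
Variables (R : realType) (k : scalar_kind).

Definition emb : scalars R k -> R[i] :=
  match k return scalars R k -> R[i] with
  | RealScalars => fun x => x%:C%C
  | ComplexScalars => id
  end.

Lemma emb0 : emb 0 = 0. Proof. by rewrite /emb; case: k. Qed.

Lemma embD x y : emb (x + y) = emb x + emb y.
Proof. by rewrite /emb; case: k x y => //= x y; rewrite -rmorphD. Qed.

Lemma embM x y : emb (x * y) = emb x * emb y.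
Proof. by rewrite /emb; case: k x y => //= x y; rewrite real_complexM. Qed.

Lemma emb_sum I (r : seq I) (F : I -> scalars R k) :
  emb (\sum_(i <- r) F i) = \sum_(i <- r) emb (F i).
Proof. exact: (big_morph emb embD emb0). Qed.

Lemma emb_conj x : emb (scalar_conj R k x) = conjc (emb x).
Proof. by rewrite /emb /scalar_conj; case: k x => //= x; rewrite oppr0. Qed.

Lemma emb_norm (V : normedZmodType (scalars R k)) (x : V) : emb `|x| = (rnorm x)%:C%C.
Proof.
rewrite /rnorm; move: (`|x|) (normr_ge0 x) => {x}; rewrite /emb /scalar_re.
by case: k => //= x x0; rewrite RRe_real // ger0_real.
Qed.

Lemma rnorm_scalar (x : scalars R k) : rnorm x ^+ 2 = sqn (emb x).
Proof.
have := emb_norm x; rewrite /emb; case: k x => x h.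
  by rewrite sqn_real; apply: real_normK (num_real (x : R)).
suff : (rnorm x ^+ 2)%:C%C = (sqn x)%:C%C by case.
by rewrite real_complexX -h; apply/esym/add_Re2_Im2.
Qed.

End ScalarEmbedding.

Section Gram.
Variables (R : realType) (k : scalar_kind) (H : hilbertSpace R k).
Local Notation Re := (@complex.Re R).

Definition cdot (f g : H) : R[i] := emb (hdot H f g).

Lemma cdotC f g : cdot f g = conjc (cdot g f).
Proof. by rewrite /cdot -emb_conj hermC expr0 mul1r. Qed.

Lemma cdot_norm f : cdot f f = (rnorm f ^+ 2)%:C%C.
Proof. by rewrite /cdot -hdotE expr2 embM emb_norm -real_complexM -expr2. Qed.

Lemma cdot_suml (I : Type) (r : seq I) (c : I -> scalars R k) (v : I -> H) g :
  cdot (\sum_(i <- r) c i *: v i) g = \sum_(i <- r) emb (c i) * cdot (v i) g.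
Proof.
rewrite /cdot linear_sumlz emb_sum; apply: eq_bigr => i _.
by rewrite linearZl_LR embM.
Qed.

Lemma rnorm_sum (I : Type) (r : seq I) (c : I -> scalars R k) (v : I -> H) :
  rnorm (\sum_(i <- r) c i *: v i) ^+ 2 =
  Re (\sum_(i <- r) \sum_(j <- r) conjc (emb (c i)) * cdot (v j) (v i) * emb (c j)).
Proof.
rewrite -[LHS]/(Re (_%:C%C)) -cdot_norm; congr (Re _).
rewrite cdotC cdot_suml rmorph_sum; apply: eq_bigr => i _ /=.
rewrite conjcM -cdotC cdot_suml mulr_sumr; apply: eq_bigr => j _.
by ring.
Qed.

Variables (I : choiceType) (u : I -> H) (B : R).
Hypothesis Bu : bessel u B.

Lemma bessel_seq (s : seq I) f : uniq s ->
  \sum_(i <- s) sqn (cdot f (u i)) <= B * rnorm f ^+ 2.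
Proof.
move=> us; rewrite -lee_fin; apply: (le_trans _ (Bu f)).
apply: esum_ge; exists [set` s]; first by split.
rewrite -fsbig_seq // sumEFin lee_fin le_eqVlt; apply/orP; left; apply/eqP.
by apply: eq_bigr => i _; rewrite rnorm_scalar.
Qed.

Variables (P : finType) (idx : P -> I).
Hypothesis idx_inj : injective idx.
Local Notation v := (fun p => u (idx p)).

Lemma bessel_fin f : \sum_p sqn (cdot f (v p)) <= B * rnorm f ^+ 2.
Proof.
have := @bessel_seq (map idx (enum P)) f; rewrite big_map big_enum; apply.
by rewrite map_inj_uniq // enum_uniq.
Qed.

Hypothesis B_ge0 : 0 <= B.

(* With f = \sum_p c p *: v p, both |f|^4 <= |c|^2 |G c|^2 and |G c|^2 <= B |f|^2. *)
Lemma gram_emb_bound (c : P -> scalars R k) :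
  \sum_p sqn (\sum_q cdot (v q) (v p) * emb (c q)) <= B ^+ 2 * \sum_p sqn (emb (c p)).
Proof.
pose f := \sum_q c q *: v q.
have fv p : cdot f (v p) = \sum_q cdot (v q) (v p) * emb (c q).
  by rewrite /f cdot_suml; apply: eq_bigr => q _; rewrite mulrC.
under eq_bigr => p _ do rewrite -fv.
have := bessel_fin f; set S := \sum_p sqn _; set N := rnorm f ^+ 2 => SN.
set V := \sum_p sqn _.
have NE : N%:C%C = \sum_p emb (c p) * conjc (cdot f (v p)).
  by rewrite -cdot_norm {1}/f cdot_suml; apply: eq_bigr => p _; rewrite -cdotC.
have S0 : 0 <= S by apply: sumr_ge0 => p _; apply: sqn_ge0.
have V0 : 0 <= V by apply: sumr_ge0 => p _; apply: sqn_ge0.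
have NV : N ^+ 2 <= V * S.
  rewrite -sqn_real NE; apply: (le_trans (cauchy_schwarz _ _)).
  rewrite ler_wpM2l // le_eqVlt; apply/orP; left; apply/eqP.
  by apply: eq_bigr => p _; rewrite sqn_conj.
have [S00|Sp] := eqVneq S 0; first by rewrite S00 mulr_ge0 ?exprn_ge0.
have {}Sp : 0 < S by rewrite lt0r Sp.
rewrite -(ler_pM2r Sp) -expr2 -mulrA.
apply: (@le_trans _ _ ((B * N) ^+ 2)); first by rewrite lerXn2r ?nnegrE // (le_trans S0).
by rewrite exprMn ler_wpM2l ?exprn_ge0.
Qed.

Lemma emb_split (x : R[i]) : exists ab : scalars R k * scalars R k,
  x = emb ab.1 + 'i%C * emb ab.2 /\ sqn x = sqn (emb ab.1) + sqn (emb ab.2).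
Proof.
rewrite /emb; case: k => /=.
  exists (complex.Re x, complex.Im x) => /=; split; last by rewrite !sqn_real.
  by case: x => a b; apply: eqcP => /=; rewrite !(mul0r, mul1r, mulr0, subr0, addr0, add0r).
by exists (x, 0); rewrite mulr0 addr0 sqn0 addr0.
Qed.

Lemma sqn_add_le (x y : R[i]) : sqn (x + y) <= 2 * (sqn x + sqn y).
Proof.
rewrite -subr_ge0 (_ : _ - _ = sqn (x - y)) ?sqn_ge0 // /sqn !cE; ring.
Qed.

(** The Bessel bound concerns coefficients in the scalar field. Over the reals a complex vector is
    split into its real and imaginary parts, at the cost of a factor 2. *)
Lemma gram_bound (w : P -> R[i]) :
  \sum_p sqn (\sum_q cdot (v q) (v p) * w q) <= 2 * B ^+ 2 * \sum_p sqn (w p).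
Proof.
have [ab abE] := choice (fun p => emb_split (w p)).
have wE p := (abE p).1; have nE p := (abE p).2.
have -> : \sum_p sqn (w p) = \sum_p sqn (emb (ab p).1) + \sum_p sqn (emb (ab p).2).
  by rewrite -big_split; apply: eq_bigr => p _; apply: nE.
have h1 := gram_emb_bound (fun p => (ab p).1).
have := ler_wpM2l (ler0n R 2) (lerD h1 (gram_emb_bound (fun p => (ab p).2))).
rewrite -mulrDr mulrA; apply: le_trans.
rewrite -big_split /= mulr_sumr; apply: ler_sum => p _.
rewrite (eq_bigr (fun q => cdot (v q) (v p) * emb (ab q).1
                         + 'i%C * (cdot (v q) (v p) * emb (ab q).2))).
  rewrite big_split /= -mulr_sumr; apply: (le_trans (sqn_add_le _ _)).
  by rewrite ler_wpM2l // lerD2l sqnM /sqn /= expr0n expr1n add0r mul1r.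
by move=> q _; rewrite {1}wE mulrDr; congr (_ + _); ring.
Qed.

End Gram.

(** * A selector for finitely many groups and systems *)

Section FiniteStage.
Variables (R : realType) (k : scalar_kind) (I : choiceType) (J L Q : finType).
Variables (H : J -> hilbertSpace R k) (u : forall j, I -> H j) (B : J -> R).
Variables (idx : L * Q -> I) (eps : R).
Hypotheses (idx_inj : injective idx) (eps_gt0 : 0 < eps) (eps_lt1 : eps < 1).
Hypotheses (J_gt0 : (0 < #|J|)%N) (B_ge1 : forall j, 1 <= B j).
Hypothesis u_bessel : forall j, bessel (u j) (B j).
Hypothesis u_norm : forall i j, rnorm (u j i) ^+ 2 = 1.
Local Notation excess := (\sum_j (B j - 1)).
Hypothesis Q_large : 32 * (1 + excess) / eps ^+ 2 <= #|Q|%:R.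

Local Notation E := (L * (Q * (J * bool)))%type.

Let sgn (b : bool) : R[i] := if b then 1 else -1.
Let gramT j (p q : L * Q) : R[i] :=
  cdot (u j (idx q)) (u j (idx p)) - (p == q)%:R.

(* Both the Gram matrix minus the identity and its opposite are needed, to bound
   the restricted Gram matrices from above and from below. *)
Definition gram_blocks (e f : E) : R[i] :=
  if e.2.2 == f.2.2 then sgn e.2.2.2 * gramT e.2.2.1 (e.1, e.2.1) (f.1, f.2.1) else 0.

Let sum_blocks (V : nmodType) (f : E -> V) :
  \sum_e f e = \sum_(d : J * bool) \sum_(p : L * Q) f (p.1, (p.2, d)).
Proof.
rewrite pair_big /= (reindex (fun x : (J * bool) * (L * Q) => (x.2.1, (x.2.2, x.1)))) //=.
by exists (fun e : E => (e.2.2, (e.1, e.2.1))) => [[? []]|[? []]].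
Qed.

Let sgn_sqn b : sqn (sgn b) = 1.
Proof. by rewrite /sgn /sqn; case: b => /=; rewrite ?sqrrN ?oppr0 expr1n expr0n addr0. Qed.

Lemma gram_blocks_herm e f : gram_blocks f e = conjc (gram_blocks e f).
Proof.
rewrite /gram_blocks eq_sym; case: eqP => [<-|_]; last by rewrite conjc0.
rewrite conjcM /gramT rmorphB /= rmorph_nat -cdotC [in RHS]eq_sym; congr (_ * _).
by rewrite /sgn; case: ifP => _; apply: eqcP; rewrite /= ?oppr0.
Qed.

Lemma gram_blocks_diag e : gram_blocks e e = 0.
Proof. by rewrite /gram_blocks eqxx /gramT eqxx cdot_norm u_norm subrr mulr0. Qed.

Let excess_ge0 : 0 <= excess.
Proof. by apply: sumr_ge0 => j _; rewrite subr_ge0. Qed.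

Let B_le j : B j <= 1 + excess.
Proof.
have : 0 <= \sum_(i | i != j) (B i - 1) by apply: sumr_ge0 => i _; rewrite subr_ge0.
by rewrite [excess](bigD1 j) //=; lra.
Qed.

(** This gives 8 B_j <= u0, enough for the norms of the blocks, and makes 4 excess / u0, the value
    used for [kap], at most eps / 2. Then [Q_large] is exactly what 2 u0 / #Q <= eps / 2
    requires. *)
Let u0 := 8 * (1 + excess) / eps.

Let u0_gt0 : 0 < u0.
Proof. by rewrite divr_gt0 // mulr_gt0 // ltr_pwDl // excess_ge0. Qed.

Let B_u0 j : 8 * B j <= u0.
Proof.
rewrite ler_pdivlMr //; apply: (@le_trans _ _ (8 * B j)).
  by rewrite ler_piMr ?(ltW eps_lt1) // mulr_ge0 // (le_trans ler01).
by rewrite ler_wpM2l // B_le.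
Qed.

(** On a block of j, |(G - 1) w|^2 <= 2 (|G w|^2 + |w|^2) <= 6 B_j^2 |w|^2, and 24 B_j^2 <= (8
    B_j)^2 <= u0^2. *)
Lemma gram_blocks_norm (v : E -> R[i]) :
  4 * \sum_e sqn (\sum_f gram_blocks e f * v f) <= u0 ^+ 2 * \sum_e sqn (v e).
Proof.
rewrite !sum_blocks !mulr_sumr; apply: ler_sum => -[j b] _.
pose w p := v (p.1, (p.2, (j, b))).
have TE (p : L * Q) : \sum_f gram_blocks (p.1, (p.2, (j, b))) f * v f =
    sgn b * (\sum_q cdot (u j (idx q)) (u j (idx p)) * w q - w p).
  rewrite sum_blocks (bigD1 (j, b)) //= [X in _ + X]big1 ?addr0 => [|d dj].
    have wE : sgn b * w p = \sum_q sgn b * ((p == q)%:R * w q).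
      rewrite (bigD1 p) //= eqxx mul1r big1 ?addr0 // => q qp.
      by rewrite eq_sym (negPf qp) mul0r mulr0.
    rewrite mulrBr wE mulr_sumr -sumrB; apply: eq_bigr => -[q1 q2] _.
    rewrite /gram_blocks eqxx /gramT /w /= -!surjective_pairing.
    by rewrite mulrBr mulrBl !mulrA.
  by apply: big1 => q _; rewrite /gram_blocks /= eq_sym (negPf dj) mul0r.
under eq_bigr => p _ do rewrite TE sqnM sgn_sqn mul1r.
have B0 : 0 <= B j by apply: le_trans (B_ge1 j).
have h1 := gram_bound (@u_bessel j) idx_inj B0 w.
have -> : \sum_p sqn (v (p.1, (p.2, (j, b)))) = \sum_p sqn (w p) by [].
set W := \sum_p sqn (w p) in h1 *.
have W0 : 0 <= W by apply: sumr_ge0 => p _; apply: sqn_ge0.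
have : \sum_p sqn (\sum_q cdot (u j (idx q)) (u j (idx p)) * w q - w p) <=
    2 * (\sum_p sqn (\sum_q cdot (u j (idx q)) (u j (idx p)) * w q) + W).
  rewrite mulrDr !mulr_sumr -big_split /=; apply: ler_sum => p _.
  by apply: (le_trans (sqn_add_le _ _)); rewrite mulrDr lerD2l /sqn !cE !sqrrN.
move: (\sum_p _) (\sum_p _) h1 => X Y h1 h2.
have h3 : 64 * (B j ^+ 2 * W) <= u0 ^+ 2 * W.
  rewrite mulrA ler_wpM2r // (_ : 64 * _ = (8 * B j) ^+ 2); last by ring.
  by rewrite lerXn2r ?nnegrE ?(ltW u0_gt0) ?B_u0 // mulr_ge0.
have h4 : W <= B j ^+ 2 * W by rewrite ler_peMl // expr_ge1.
apply: le_trans h3; rewrite -mulrA in h1.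
lra.
Qed.

(** The Bessel inequality for f = u_i contains the term 1 of u_i itself, which the subtraction of
    the identity removes. *)
Lemma gram_blocks_row e : \sum_f sqn (gram_blocks e f) <= B e.2.2.1 - 1.
Proof.
case: e => l [q [j b]] /=; rewrite sum_blocks (bigD1 (j, b)) //=.
rewrite [X in _ + X]big1 ?addr0 => [|d dj]; last first.
  by apply: big1 => p _; rewrite /gram_blocks /= eq_sym (negPf dj) sqn0.
have := bessel_fin (@u_bessel j) idx_inj (u j (idx (l, q))).
rewrite u_norm mulr1 (bigD1 (l, q)) //= cdot_norm u_norm sqn_real expr1n -lerBrDl.
apply: le_trans; rewrite (bigD1 (l, q)) //= /gram_blocks eqxx.
rewrite sqnM sgn_sqn mul1r /gramT eqxx cdot_norm u_norm subrr sqn0 add0r.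
apply: ler_sum => -[p1 p2] pl; rewrite sqnM sgn_sqn mul1r [_ == (p1, p2)]eq_sym.
by rewrite (negPf pl) subr0 cdotC sqn_conj.
Qed.

Lemma finite_stage : exists s : L -> Q, forall j (c : L -> scalars R k),
  (1 - eps) * \sum_l rnorm (c l) ^+ 2 <=
    rnorm (\sum_l c l *: u j (idx (l, s l))) ^+ 2 <=
  (1 + eps) * \sum_l rnorm (c l) ^+ 2.
Proof.
have Q0 : 0 < #|Q|%:R :> R.
  apply: lt_le_trans Q_large; rewrite divr_gt0 ?exprn_gt0 // mulr_gt0 //.
  by rewrite ltr_pwDl // excess_ge0.
have u0E : u0 * eps = 8 * (1 + excess) by rewrite divfK ?gt_eqF.
have [||||||s sP] := @selection_form R L Q (J * bool)%type gram_blocks gram_blocks_herm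
   gram_blocks_diag u0 eps (4 * excess / u0) (fun e => B e.2.2.1 - 1) u0_gt0
   gram_blocks_norm gram_blocks_row.
- move=> e; have h1 := B_u0 e.2.2.1; have h2 := B_ge1 e.2.2.1.
  apply: (@le_trans _ _ (B e.2.2.1 * u0)); first by nra.
  by rewrite expr2 ler_wpM2r ?(ltW u0_gt0) //; lra.
- by move: Q0; rewrite ltr0n.
- by rewrite card_prod card_bool muln_gt0 J_gt0.
(* The two signs of each system turn the 2 (B_j - 1) / u0 of a block into the 4 of [kap]. *)
- move=> l; rewrite le_eqVlt; apply/orP; left; apply/eqP.
  rewrite -(pair_big xpredT xpredT (fun q d => 2 * (B d.1 - 1) / u0)) /=.
  rewrite sumr_const -[X in _ * X]mulr_natl mulKf ?gt_eqF //.
  rewrite -(pair_big xpredT xpredT (fun j (b : bool) => 2 * (B j - 1) / u0)) /=.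
  rewrite mulr_sumr mulr_suml; apply: eq_bigr => j _.
  by rewrite big_bool /=; ring.
- have h1 : 4 * excess / u0 <= eps / 2.
    rewrite ler_pdivrMr // mulrAC [eps * _]mulrC u0E; have := excess_ge0; lra.
  have h2 : 2 * u0 * #|Q|%:R^-1 <= eps / 2.
    rewrite ler_pdivrMr // mulrAC ler_pdivlMr //.
    have := ler_wpM2r (ltW eps_gt0) Q_large.
    rewrite (_ : 32 * _ / _ * _ = 4 * u0); first by lra.
    by rewrite /u0; field; rewrite gt_eqF.
  lra.
- exact: eps_gt0.
exists s => j c; pose e l := emb (c l).
have NE : \sum_l rnorm (c l) ^+ 2 = \sum_l sqn (e l).
  by apply: eq_bigr => l _; rewrite rnorm_scalar.
pose v l := u j (idx (l, s l)).
have form b : complex.Re (\sum_l \sum_m conjc (e l) *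
      gram_blocks (l, (s l, (j, b))) (m, (s m, (j, b))) * e m) =
    (if b then 1 else -1) * (rnorm (\sum_l c l *: v l) ^+ 2 - \sum_l sqn (e l)).
  have -> : \sum_l \sum_m conjc (e l) * gram_blocks (l, (s l, (j, b))) (m, (s m, (j, b))) * e m =
      sgn b * (\sum_l \sum_m conjc (e l) * cdot (v m) (v l) * e m -
               (\sum_l sqn (e l))%:C%C).
    rewrite -[(\sum_l sqn _)%:C%C]/(real_complex R _) rmorph_sum -sumrB mulr_sumr.
    apply: eq_bigr => l _ /=; rewrite -conjcM_re.
    have -> : e l * conjc (e l) = \sum_m conjc (e l) * (l == m)%:R * e m.
      rewrite (bigD1 l) //= eqxx mulr1 big1 ?addr0 1?mulrC // => m ml.
      by rewrite eq_sym (negPf ml) mulr0 mul0r.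
    rewrite -sumrB mulr_sumr; apply: eq_bigr => m _.
    rewrite /gram_blocks eqxx /gramT /= xpair_eqE.
    have -> : (l == m) && (s l == s m) = (l == m) by case: eqP => [->|]; rewrite ?eqxx.
    by rewrite -/(v m) -/(v l); move: ((l == m)%:R : R[i]) => d; ring.
  have ReS (y : R[i]) : complex.Re (sgn b * y) = (if b then 1 else -1) * complex.Re y.
    by rewrite /sgn; case: b; case: y => y1 y2 /=; rewrite ?oppr0 mul0r subr0.
  by rewrite ReS rnorm_sum; congr (_ * _); rewrite !cE.
have h1 := sP (j, true) e; have h2 := sP (j, false) e.
rewrite !form in h1 h2; rewrite NE -/v; move: h1 h2.
move: (rnorm _ ^+ 2) (\sum_l sqn _) => X Y h1 h2.
by apply/andP; split; lra.
Qed.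
End FiniteStage.

(** * Ultrafilter limit of the finite stages *)

Section Assembly.
Variables (R : realType) (k : scalar_kind) (I N : countType) (K : Type).
Variables (H : N -> hilbertSpace R k) (u : forall j, I -> H j) (B : N -> R).
Variables (eps : R) (j0 : N) (k0 : K) (n0 : nat) (A : K -> seq I).
Hypotheses (eps_gt0 : 0 < eps) (eps_lt1 : eps < 1) (B_ge1 : forall j, 1 <= B j).
Hypothesis u_bessel : forall j, bessel (u j) (B j).
Hypothesis u_norm : forall i j, rnorm (u j i) ^+ 2 = 1.
Hypotheses (n0_gt0 : (0 < n0)%N) (A_size : forall k', size (A k') = n0).
Hypothesis A_uniq : forall k', uniq (A k').
Hypothesis A_disj : forall k1 k2 x, x \in A k1 -> x \in A k2 -> k1 = k2.
Hypothesis n0_large : forall s : seq N, uniq s ->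
  32 * (1 + \sum_(j <- s) (B j - 1)) / eps ^+ 2 <= n0%:R.

Let i0 : I.
Proof. by case: (A k0) (A_size k0) => [h|//]; move: n0_gt0; rewrite -h. Qed.

(** K is an arbitrary type. The disjoint groups are enumerated through their first elements, which
    lie in the countable type I. *)
Let rep (k' : K) : I := nth i0 (A k') 0.

Let rep_in k' : rep k' \in A k'. Proof. by rewrite mem_nth // A_size. Qed.

Let rep_inj k1 k2 : rep k1 = rep k2 -> k1 = k2.
Proof. by move=> e; apply: (A_disj (rep_in k1)); rewrite e. Qed.

Let owner (i : I) : K :=
  if pselect (exists k', rep k' = i) is left ex then projT1 (cid ex) else k0.

Let repK k' : owner (rep k') = k'.
Proof.
rewrite /owner; case: pselect => [ex|[]]; last by exists k'.
by apply: rep_inj; case: (cid ex).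
Qed.

Let small (T : countType) n : seq T := pmap pickle_inv (iota 0 n).

Let small_uniq (T : countType) n : uniq (small T n).
Proof. exact: (pmap_uniq (@pickle_invK T) (iota_uniq 0 n)). Qed.

Let mem_small (T : countType) n (x : T) : (pickle x < n)%N -> x \in small T n.
Proof.
by move=> xn; rewrite mem_pmap -(pickleK_inv x) map_f // mem_iota.
Qed.

Definition riesz_on (s : seq I) j (c : I -> scalars R k) :=
  (1 - eps) * (\sum_(i <- s) rnorm (c i) ^+ 2)
      <= rnorm (\sum_(i <- s) c i *: u j i) ^+ 2
      <= (1 + eps) * (\sum_(i <- s) rnorm (c i) ^+ 2).

(** Stage n treats finitely many groups and systems, but the group size n0 does not depend on n.
    Each clause can be tested on finitely many elements and so passes to an ultrafilter limit. *)
Definition good_stage n (S : set I) :=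
  [/\ forall k', (pickle (rep k') < n)%N -> exists2 x, x \in A k' & S x,
      forall k' x y, x \in A k' -> y \in A k' -> S x -> S y -> x = y,
      forall x, S x -> exists k', x \in A k'
    & forall j s c, (pickle j < n)%N -> uniq s -> (forall i, i \in s -> S i) ->
        riesz_on s j c].

Lemma stage n : exists S, good_stage n S.
Proof.
pose reps := [seq i <- small I n | rep (owner i) == i].
(* [j0] keeps the list of systems nonempty for small n. *)
pose js := undup (j0 :: small N n).
pose rp (l : 'I_(size reps)) := nth i0 reps l; pose ow l := owner (rp l).
have rpE l : rep (ow l) = rp l.
  have : rp l \in reps by apply: mem_nth.
  by rewrite mem_filter => /andP[/eqP].
have ow_inj l l' : ow l = ow l' -> l = l'.
  move=> e; apply: val_inj; apply/eqP; rewrite -(nth_uniq i0 (ltn_ord l) (ltn_ord l')).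
    by rewrite -/(rp l) -/(rp l') -!rpE e.
  by rewrite filter_uniq.
pose jn (t : 'I_(size js)) := nth j0 js t.
pose idx (p : 'I_(size reps) * 'I_n0) := nth i0 (A (ow p.1)) p.2.
have idx_in p : idx p \in A (ow p.1) by apply: mem_nth; rewrite A_size.
have idx_inj : injective idx.
  move=> [l q] [l' q'] e; have ll : l = l'.
    by apply: ow_inj; apply: (A_disj (idx_in (l, q))); rewrite e; apply: idx_in.
  subst l'; congr (_, _); apply: val_inj; apply/eqP.
  rewrite -(nth_uniq i0 _ _ (A_uniq (ow l))) ?A_size ?ltn_ord //.
  by apply/eqP; exact: e.
have js_large : 32 * (1 + \sum_t (B (jn t) - 1)) / eps ^+ 2 <= #|'I_n0|%:R.
  have := n0_large (undup_uniq (j0 :: small N n)).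
  by rewrite card_ord -/js (big_nth j0) big_mkord.
have js_gt0 : (0 < #|'I_(size js)|)%N.
  have : j0 \in js by rewrite mem_undup mem_head.
  by rewrite card_ord; case: (js).
have [s sP] := finite_stage idx_inj eps_gt0 eps_lt1 js_gt0
  (fun t => B_ge1 (jn t)) (fun t => @u_bessel (jn t)) (fun i t => u_norm i (jn t)) js_large.
pose sel l := idx (l, s l).
have sel_inj : injective sel by move=> l l' e; have [] := idx_inj _ _ e.
exists [set x | exists l, x = sel l]; split.
- move=> k' kn; have rk : rep k' \in reps.
    by rewrite mem_filter repK eqxx mem_small.
  have lt : (index (rep k') reps < size reps)%N by rewrite index_mem.
  exists (sel (Ordinal lt)); last by exists (Ordinal lt).
  have := idx_in (Ordinal lt, s (Ordinal lt)).
  by rewrite /ow /rp /= nth_index // repK.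
- move=> k' x y xA yA [l xl] [l' yl]; rewrite xl yl; congr sel; apply: ow_inj.
  rewrite xl in xA; rewrite yl in yA.
  by rewrite (A_disj (idx_in _) xA) (A_disj (idx_in _) yA).
- by move=> x [l ->]; exists (ow l); apply: idx_in.
move=> j t c jn' ut tS.
have jjs : j \in js by rewrite mem_undup in_cons mem_small ?orbT.
have lt : (index j js < size js)%N by rewrite index_mem.
(* Coefficients on t are extended by 0 to all selected elements. *)
have := sP (Ordinal lt) (fun l => if sel l \in t then c (sel l) else 0).
rewrite /jn /= nth_index // /riesz_on.
have tE : perm_eq t [seq sel l | l <- enum 'I_(size reps) & sel l \in t].
  apply: uniq_perm => //; first by rewrite map_inj_uniq // filter_uniq // enum_uniq.
  move=> i; apply/idP/mapP => [it|[l]]; last by rewrite mem_filter => /andP[lt' _] ->.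
  have [l il] := tS i it; exists l => //.
  by rewrite mem_filter -il it mem_enum.
have sumE (V : nmodType) (F : I -> V) (F' : 'I_(size reps) -> V) :
    (forall l, sel l \in t -> F' l = F (sel l)) -> (forall l, sel l \notin t -> F' l = 0) ->
    \sum_l F' l = \sum_(i <- t) F i.
  move=> h1 h2; rewrite (perm_big _ tE) big_map big_filter big_enum_cond /=.
  rewrite [RHS]big_mkcond /=; apply: eq_bigr => l _; case: ifPn => [/h1|/h2] //.
rewrite (sumE _ (fun i => rnorm (c i) ^+ 2)); first last.
- by move=> l /negPf ->; rewrite rnorm_scalar emb0 sqn0.
- by move=> l ->.
rewrite (sumE _ (fun i => c i *: u j i)) //.
- by move=> l ->.
- by move=> l /negPf ->; rewrite scale0r.
Qed.

(** An element is selected when the stages containing it form a set of the ultrafilter. If no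
    element of the finite list A k' were selected, almost all stages would avoid A k'. A Riesz
    inequality involves finitely many elements, hence can be read off at a single stage. *)
Lemma assembled_selector : exists S : set I,
  [/\ forall x, S x -> exists k', x \in A k',
      forall k', exists2 x, x \in A k' & S x,
      forall k' x y, x \in A k' -> y \in A k' -> S x -> S y -> x = y
    & forall j s c, uniq s -> (forall i, i \in s -> S i) -> riesz_on s j c].
Proof.
have [Sn SnP] := choice stage.
have [G [GU Gle]] := @ultraFilterLemma nat \oo _.
have FG : Filter G by exact: _.
have big m : G [set n | (m < n)%N] by apply: Gle; exact: nbhs_infty_gt.
exists [set i | G [set n | Sn n i]]; split.
- move=> x /= /filter_ex[n /=]; have [_ _ + _] := SnP n; exact.
- move=> k'; apply: contrapT => no.
  have out x : x \in A k' -> G [set n | ~ Sn n x].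
    move=> xA; have [h|//] := @in_ultra_setVsetC _ G [set n | Sn n x] GU.
    by exfalso; apply: no; exists x.
  have : G [set n | forall x, x \in A k' -> ~ Sn n x].
    elim: (A k') out => [|y s IH] out; first by apply: filterS filterT.
    have tl x : x \in s -> x \in y :: s by rewrite in_cons => ->; rewrite orbT.
    have h := @filterI _ G FG _ _ (out y (mem_head _ _)) (IH (fun x xs => out x (tl x xs))).
    apply: filterS h => n [h1 h2] x; rewrite in_cons => /orP[/eqP ->|] //; exact: h2.
  move=> /(@filterI _ G FG _ _ (big (pickle (rep k'))))/filter_ex[n [/= h1 h2]].
  have [/(_ k' h1) [x xA Sx] _ _ _] := SnP n.
  exact: h2 xA Sx.
- move=> k' x y xA yA /= Gx Gy; have /filter_ex[n [/= Sx Sy]] := @filterI _ G FG _ _ Gx Gy.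
  by have [_ + _ _] := SnP n; apply; eauto.
- move=> j s c us sS; have : G [set n | forall i, i \in s -> Sn n i].
    elim: s {us} sS => [|y s IH] sS; first by apply: filterS filterT.
    have tl x : x \in s -> x \in y :: s by rewrite in_cons => ->; rewrite orbT.
    have h := @filterI _ G FG _ _ (sS y (mem_head _ _)) (IH (fun x xs => sS x (tl x xs))).
    apply: filterS h => n [h1 h2] x; rewrite in_cons => /orP[/eqP ->|] //; exact: h2.
  move=> /(@filterI _ G FG _ _ (big (pickle j)))/filter_ex[n [/= h1 h2]].
  by have [_ _ _ +] := SnP n; apply.
Qed.

End Assembly.

(** * From the hypotheses of the theorem to finite lists *)

Lemma esum_ge_seq (R : realType) (T : choiceType) (D : set T) (f : T -> R) (s : seq T) :
  uniq s -> (forall x, x \in s -> D x) ->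
  ((\sum_(x <- s) f x)%:E <= \esum_(x in D) (f x)%:E)%E.
Proof.
move=> us sD; apply: esum_ge; exists [set` s]; first by split=> // x /= /sD.
by rewrite -fsbig_seq // sumEFin.
Qed.

(** The first condition says that n is at most the least natural number not below x. Groups,
    possibly infinite, are cut to a common size because a finite stage has one set Q of candidates
    for all groups. *)
Lemma counting_seq (R : realType) (T : choiceType) (X : set T) (n : nat) (x : R) :
  (forall m : nat, x <= m%:R -> (n <= m)%N) -> (x%:E <= counting X)%E ->
  exists s : seq T, [/\ uniq s, size s = n & forall y, y \in s -> X y].
Proof.
move=> xn; rewrite /counting; case: asboolP => [fX|iX] h.
  exists (take n (finmap.enum_fset (fset_set X))); split.
  - by rewrite take_uniq // finmap.fset_uniq.
  - by rewrite size_takel // xn // -lee_fin.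
  - by move=> y /mem_take; rewrite in_fset_set // inE.
have [Y YX nY] := infinite_set_fset n iX.
exists (take n (finmap.enum_fset Y)); split.
- by rewrite take_uniq // finmap.fset_uniq.
- by rewrite size_takel.
- by move=> y /mem_take yY; apply: YX.
Qed.

Lemma bessel_ge1 (R : realType) (k : scalar_kind) (H : hilbertSpace R k)
    (I : choiceType) (u : I -> H) (B : R) (i : I) :
  bessel u B -> rnorm (u i) ^+ 2 = 1 -> 1 <= B.
Proof.
move=> Bu u1; have := bessel_seq Bu (s := [:: i]) (u i) isT.
by rewrite big_seq1 cdot_norm u1 sqn_real expr1n mulr1.
Qed.

Lemma riesz_sequence_on (R : realType) (k : scalar_kind) (H : hilbertSpace R k)
    (I : choiceType) (J : set I) (u : I -> H) (e : R) : e < 1 ->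
  (forall (s : seq I) (c : I -> scalars R k), uniq s -> (forall i, i \in s -> J i) ->
    (1 - e) * (\sum_(i <- s) rnorm (c i) ^+ 2)
      <= rnorm (\sum_(i <- s) c i *: u i) ^+ 2
      <= (1 + e) * (\sum_(i <- s) rnorm (c i) ^+ 2)) ->
  riesz_sequence J u (1 - e) (1 + e).
Proof.
move=> e1 Hs; split; first by rewrite subr_gt0.
move=> c fc; pose s : seq I := finmap.enum_fset (fset_set (J `&` [set i | c i != 0])).
have us : uniq s by apply: finmap.fset_uniq.
have sE i : i \in s = ((i \in J) && (c i != 0)).
  by rewrite in_fset_set // in_setI; congr (_ && _); apply/idP/idP; rewrite inE.
have sJ i : i \in s -> J i by rewrite sE => /andP[/set_mem].
have sumE (V : nmodType) (F : I -> V) : (forall i, c i = 0 -> F i = 0) ->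
    \sum_(i \in J) F i = \sum_(i <- s) F i.
  move=> F0; rewrite (fsbigE s) //.
    rewrite big_seq_cond [RHS]big_seq; apply: eq_bigl => i.
    by rewrite andb_idr // => /sJ/mem_set.
  move=> i Ji; rewrite sE mem_set //= negbK => /eqP; exact: F0.
rewrite (sumE _ (fun i => rnorm (c i) ^+ 2)) => [|i ->]; last first.
  by rewrite rnorm_scalar emb0 sqn0.
rewrite (sumE _ (fun i => c i *: u i)) => [|i ->]; last by rewrite scale0r.
exact: Hs.
Qed.

(** Real lower bounds of r. With a = b = 0 they show that a group is nonempty, before anything is
    known about B; later a and b are the sums themselves. *)
Lemma radius_ge (R : realType) (c w a b : R) (S1 S2 S3 : \bar R) :
  0 <= c -> 0 <= w -> 0 <= a -> (a%:E <= S1)%E -> (0 <= S2)%E -> (b%:E <= S3)%E ->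
  ((c * (1 + w * a) * Num.max 1 b)%:E <= c%:E * (1 + w%:E * S1) * maxe 1 (S2 + S3))%E.
Proof.
move=> c0 w0 a0 aS S20 bS.
rewrite EFinM [(c * _)%:E]EFinM [(1 + _)%:E]EFinD [(w * a)%:E]EFinM EFin_max.
apply: lee_pmul.
- by rewrite -EFinM -EFinD -EFinM lee_fin mulr_ge0 // addr_ge0 // mulr_ge0.
- by rewrite -EFin_max lee_fin le_max ler01.
- apply: lee_wpmul2l; first by rewrite lee_fin.
  by apply: leeD2l; apply: lee_wpmul2l.
rewrite ge_max !le_max lexx /=; apply/orP; right.
by apply: (le_trans bS); rewrite leeDr.
Qed.

Theorem theorem4p6 (R : realType) :
  exists C : R, 0 < C /\
  forall (k : scalar_kind) (I N : countType) (e : R)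
    (H : N -> hilbertSpace R k) (u : forall j : N, I -> H j) (B : N -> R)
    (j0 : N) (K : Type) (Js : K -> set I),
  let eps := fun j : N => 1 / B j in
  let r : \bar R :=
    ((C / e ^+ 2)%:E
     * (1 + (1 / eps j0 ^+ 2)%:E
            * \esum_(j in [set j | (eps j < 1 / 2)%R]) (eps j)%:E)
     * maxe 1 (\esum_(j in [set j | (eps j < 1 / (1 + e))%R]) (eps j)%:E
               + \esum_(j in [set: N]) (1 - eps j)%:E))%E in
  0 < e < 1 ->
  (forall j, bessel (u j) (B j)) ->
  (forall i j, rnorm (u j i) ^+ 2 = 1) ->
  (\esum_(j in [set: N]) (1 - eps j)%:E < +oo)%E ->
  (forall j, eps j0 <= eps j) ->
  trivIset [set: K] Js ->
  (forall k', (r <= counting (Js k'))%E) ->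
  exists J : set I,
    [/\ J `<=` \bigcup_(k' in [set: K]) Js k',
        forall k', (J `&` Js k' #= `I_1)%card
      & forall j, riesz_sequence J (u j) (1 - e) (1 + e)].
Proof.
exists 96; split=> // k I N e H u B j0 K Js eps r /andP[e0 e1] uB u1 S3fin epsmin triv rle.
have [[k0]|noK] := pselect (inhabited K); last first.
  exists set0; split=> [//|k'|j]; first by exfalso; apply: noK.
  apply: riesz_sequence_on => // s c _ s0.
  suff -> : s = [::].
    by rewrite rnorm_sum !big_nil !mulr0 lexx.
  by case: s s0 => // x s /(_ x (mem_head _ _)).
pose S2 : \bar R := (\esum_(j in [set j | (eps j < 1 / (1 + e))%R]) (eps j)%:E)%E.
pose S3 : \bar R := (\esum_(j in [set: N]) (1 - eps j)%:E)%E.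
pose S1 : \bar R := (\esum_(j in [set j | (eps j < 1 / 2)%R]) (eps j)%:E)%E.
have esum_ge00 (D : set N) f : (0%E <= \esum_(j in D) (f j : R)%:E)%E.
  by have := @esum_ge_seq R N D f [::] isT; rewrite big_nil; apply.
have S10 : (0 <= S1)%E by apply: esum_ge00.
have S20 : (0 <= S2)%E by apply: esum_ge00.
have S30 : (0 <= S3)%E by apply: esum_ge00.
have C0 : 0 < 96 / e ^+ 2 by rewrite divr_gt0 // exprn_gt0.
have w0 : 0 <= 1 / eps j0 ^+ 2 by rewrite divr_ge0 // sqr_ge0.
have r_ge (a b : R) : 0 <= a -> (a%:E <= S1)%E -> 0 <= b -> (b%:E <= S3)%E ->
    ((96 / e ^+ 2 * (1 + 1 / eps j0 ^+ 2 * a) * Num.max 1 b)%:E <= r)%E.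
  by move=> a0 aS b0 bS; apply: radius_ge => //; apply: ltW.
(* Since r > 0, the group of [k0] has an element i, and the Bessel inequality at the unit vector u_i
   gives the bound. *)
have B1 : forall j, 1 <= B j.
  move=> j; have r0 := le_trans (r_ge 0 0 (lexx _) S10 (lexx _) S30) (rle k0).
  have r_min (m : nat) :
      96 / e ^+ 2 * (1 + 1 / eps j0 ^+ 2 * 0) * Num.max 1 0 <= m%:R -> (1 <= m)%N.
    move=> h; rewrite lt0n; apply: contraTneq h => ->.
    by rewrite -ltNge mulr0 addr0 mulr1 mulr_gt0 // lt_max ltr01.
  have [[|i s] [_ // _ /(_ i (mem_head _ _)) Xi]] := counting_seq r_min r0.
  exact: (bessel_ge1 (uB j) (u1 i j)).
have eps0 j : 0 < eps j by rewrite divr_gt0 // (lt_le_trans ltr01).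
have eps1 j : eps j <= 1 by rewrite /eps div1r invf_le1 // (lt_le_trans ltr01).
(* If eps j < 1/2 then eps j <= 1 - eps j. This makes [S1] finite. *)
have S13 : (S1 <= S3)%E.
  rewrite /S1 esum_mkcond; apply: le_esum => j _.
  by case: ifP => [/set_mem /= h|_]; rewrite lee_fin ?subr_ge0 //; lra.
pose s1 := fine S1; pose s3 := fine S3.
have S3E : s3%:E = S3 by rewrite fineK // ge0_fin_numE.
have S1E : s1%:E = S1 by rewrite fineK // ge0_fin_numE // (le_lt_trans S13).
have s10 : 0 <= s1 by rewrite fine_ge0.
have s30 : 0 <= s3 by rewrite fine_ge0.
pose r' := 96 / e ^+ 2 * (1 + 1 / eps j0 ^+ 2 * s1) * Num.max 1 s3.
have r'r : (r'%:E <= r)%E by apply: r_ge; rewrite ?S3E ?S1E.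
have r'0 : 0 < r'.
  rewrite /r' !mulr_gt0 ?invr_gt0 ?exprn_gt0 ?lt_max ?ltr01 //.
  by rewrite ltr_pwDl // mulr_ge0.
pose n0 := `|Num.ceil r'|%N.
have n0E : n0%:R = (Num.ceil r')%:~R :> R.
  by rewrite /n0 natr_absz ger0_norm // ceil_ge0 (lt_trans _ r'0) // ltrN10.
have r'n : r' <= n0%:R by rewrite n0E ceil_ge.
have n0_min (m : nat) : r' <= m%:R -> (n0 <= m)%N.
  by move=> h; rewrite -(ler_nat R) n0E -[m%:R]/((m%:Z)%:~R) ler_int ceil_le_int.
have n0_gt0 : (0 < n0)%N by rewrite -(ltr_nat R) (lt_le_trans r'0).
have [A AP] := choice (fun k' => counting_seq n0_min (le_trans r'r (rle k'))).
have A_in k' x : x \in A k' -> Js k' x by have [_ _] := AP k'; apply.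
have same k1 k2 x : Js k1 x -> Js k2 x -> k1 = k2.
  by move=> h1 h2; apply: triv => //; exists x.
have [||||S [SA AS Suniq Sriesz]] := @assembled_selector R k I N K H u B e j0 k0 n0 A
  e0 e1 B1 uB u1 n0_gt0.
- by move=> k'; have [] := AP k'.
- by move=> k'; have [] := AP k'.
- by move=> k1 k2 x /A_in h1 /A_in h2; apply: same h1 h2.
- move=> s us; apply: le_trans r'n.
  have s3P : \sum_(j <- s) (1 - eps j) <= s3.
    by rewrite -lee_fin S3E; apply: esum_ge_seq.
  have s1P : \sum_(j <- s | eps j < 1 / 2) eps j <= s1.
    rewrite -big_filter -lee_fin S1E; apply: esum_ge_seq; first exact: filter_uniq.
    by move=> j; rewrite mem_filter => /andP[].
  (* If eps j >= 1/2, then B_j - 1 = (1 - eps j) / eps j <= 2 (1 - eps j). If eps j < 1/2, then B_j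
     = eps j / eps j ^ 2 <= eps j / eps j0 ^ 2. *)
  have sumB : \sum_(j <- s) (B j - 1) <= 2 * s3 + 1 / eps j0 ^+ 2 * s1.
    apply: (@le_trans _ _ (2 * \sum_(j <- s) (1 - eps j)
        + 1 / eps j0 ^+ 2 * \sum_(j <- s | eps j < 1 / 2) eps j)); last first.
      by rewrite lerD ?ler_wpM2l.
    rewrite [\sum_(j <- s | eps j < _) _]big_mkcond !mulr_sumr -big_split /=.
    apply: ler_sum => j _; have BE : B j = (eps j)^-1 by rewrite /eps div1r invrK.
    case: ifPn => [small|].
      have h : (eps j)^-1 <= 1 / eps j0 ^+ 2 * eps j.
        rewrite mul1r mulrC ler_pdivlMr ?exprn_gt0 // mulrC ler_pdivrMr //.
        by rewrite -expr2 lerXn2r ?nnegrE ?(ltW (eps0 _)).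
      by have := eps1 j; rewrite BE; lra.
    rewrite -leNgt => big; rewrite mulr0 addr0 BE -(ler_pM2r (eps0 j)).
    by rewrite mulrBl mulVf ?gt_eqF //; have := eps1 j; nra.
  (* With p = s1 / eps j0 ^ 2 and M = max 1 s3 one has 1 + 2 s3 + p <= 3 (1 + p) M. This 3 times the
     32 of the finite stage is the constant 96. *)
  rewrite [32 * _]mulrC -mulrA [X in _ <= X](_ : _ =
    (3 * ((1 + 1 / eps j0 ^+ 2 * s1) * Num.max 1 s3)) * (32 / e ^+ 2)); last first.
    by rewrite /r'; ring.
  rewrite ler_wpM2r ?divr_ge0 ?exprn_ge0 ?(ltW e0) //.
  have M1 : 1 <= Num.max 1 s3 by rewrite le_max lexx.
  have M3 : s3 <= Num.max 1 s3 by rewrite le_max lexx orbT.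
  have p0 := mulr_ge0 w0 s10.
  set p := _ * s1 in sumB p0 *; set M := Num.max _ _ in M1 M3 *.
  by have := ler_peMr p0 M1; lra.
exists S; split=> [x /SA[k' /A_in]|k'|j]; first by exists k'.
  have [x xA Sx] := AS k'.
  suff -> : S `&` Js k' = [set x] by apply: card_set1.
  apply/seteqP; split=> [y [Sy Jy]|y ->] /=; last by split=> //; apply: A_in.
  have [k'' yA] := SA y Sy; have kk := same _ _ _ (A_in _ _ yA) Jy.
  by apply: (Suniq k'); rewrite -?kk //; rewrite kk.
apply: riesz_sequence_on => // s c us sS; exact: Sriesz.
Qed.
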